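(* Let $\Omega \subset \mathbb{C}^n$ be a bounded domain with $C^0$-boundary. Then every function in $\mathcal{PSH}(\Omega) \cap C(\overline{\Omega})$ can be uniformly approximated on $\overline{\Omega}$ by functions in $\mathcal{PSH}(\overline{\Omega}) \cap C^\infty(\overline{\Omega})$.
   Context: A domain is a connected open set. $\mathbb{C}^n$ is identified with $\mathbb{R}^{2n}$ in the canonical way, and $B(x,r)$ denotes the open Euclidean ball. A bounded open set $\Omega \subset \mathbb{R}^m$ has $C^0$-boundary if there exists a finite set of balls $\{B(x_j,r_j)\}$, with $x_j \in \partial\Omega$ and $r_j>0$, that covers an open neighbourhood of $\partial\Omega$ and such that, for each $j$, in an appropriate (Euclidean) coordinate system $y=(y',y_m)$, $$\Omega\cap B(x_j,4r_j)=\{y : y_m>\phi_j(y')\}\cap B(x_j,4r_j),\qquad \partial\Omega\cap B(x_j,4r_j)=\{y : y_m=\phi_j(y')\}\cap B(x_j,4r_j),$$ where $\phi_j:\mathbb{R}^{m-1}\to\mathbb{R}$ is continuous. $\mathcal{PSH}(\Omega)$ is the class of plurisubharmonic functions on $\Omega$, and $\mathcal{PSH}(\overline{\Omega})$ is the class of functions that are plurisubharmonic on some neighbourhood of $\overline{\Omega}$ (the neighbourhood may depend on the function). *)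

(* Defs.v *)
From mathcomp Require Export all_boot all_order all_algebra.
From mathcomp Require Export all_classical all_reals all_analysis.
From mathcomp.real_closed Require Export complex.
Export Order.TTheory GRing.Theory Num.Theory.
Export numFieldNormedType.Exports.

Set Implicit Arguments.
Unset Strict Implicit.
Unset Printing Implicit Defensive.

Local Open Scope classical_set_scope.
Local Open Scope ring_scope.

(* The norm that the library puts on ['rV[R]_m] is the sup norm.  It induces
   the same open, closed, bounded and connected sets as the Euclidean norm, so
   the library notions are used for these, but balls have to be Euclidean. *)
Definition enorm (R : realType) (m : nat) (x : 'rV[R]_m) : R :=
  Num.sqrt (\sum_(i < m) x 0 i ^+ 2).

Definition eball (R : realType) (m : nat) (x : 'rV[R]_m) (r : R) :
    set 'rV[R]_m :=
  [set y | enorm (y - x) < r].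

Definition bdry (T : topologicalType) (A : set T) : set T :=
  closure A `\` interior A.

(* A Euclidean coordinate system on R^m consists of an origin [a] and an
   orthogonal matrix [Q]. *)
Definition euclidean_coord (R : realType) (m : nat) (a : 'rV[R]_m)
    (Q : 'M[R]_m) (x : 'rV[R]_m) : 'rV[R]_m :=
  (x - a) *m Q.

(* [l] is the index of the last coordinate, so that [y 0 l] is y_m and
   [col' l y] is y' = (y_1, ..., y_(m-1)). *)
Definition C0_boundary (R : realType) (m : nat) (Omega : set 'rV[R]_m) : Prop :=
  exists balls : seq ('rV[R]_m * R),
    [/\ forall b, b \in balls -> bdry Omega b.1 /\ 0 < b.2,
        exists U : set 'rV[R]_m,
          [/\ open U, bdry Omega `<=` U &
              U `<=` [set x | exists2 b, b \in balls & eball b.1 b.2 x]]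
      & forall b, b \in balls ->
        exists (l : 'I_m) (a : 'rV[R]_m) (Q : 'M[R]_m)
               (phi : 'rV[R]_m.-1 -> R),
          let y := euclidean_coord a Q in
          [/\ l.+1 = m, Q *m Q^T = 1%:M, continuous phi,
              Omega `&` eball b.1 (4 * b.2) =
                [set x | phi (col' l (y x)) < y x 0 l]
                  `&` eball b.1 (4 * b.2)
            & bdry Omega `&` eball b.1 (4 * b.2) =
                [set x | y x 0 l = phi (col' l (y x))]
                  `&` eball b.1 (4 * b.2)]].

(* The identification of C^n with R^(2n), z = x + iy |-> (x, y). *)
Definition realify (R : realType) (n : nat) (z : 'rV[R[i]]_n) :
    'rV[R]_(n + n) :=
  row_mx (map_mx (@complex.Re R) z) (map_mx (@complex.Im R) z).

Definition circle_pt (R : realType) (c : R[i]) (r t : R) : R[i] :=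
  c + r%:C%C * (cos t +i* sin t)%C.

(* The integral is meaningful for an upper semicontinuous [v] < +oo: such a [v]
   is Borel and bounded above on the circle, so only -oo can occur. *)
Definition submean (R : realType) (V : set R[i]) (v : R[i] -> \bar R) : Prop :=
  forall (c : R[i]) (r : R), 0 < r ->
    [set z : R[i] | `|z - c| <= r%:C%C] `<=` V ->
    (v c <= ((2 * pi)^-1)%:E *
      \int[lebesgue_measure]_(t in `[0%R, (2 * pi)%R])
         v (circle_pt c r t))%E.

Definition usc_on (T : topologicalType) (R : realType) (A : set T)
    (u : T -> \bar R) : Prop :=
  forall x, A x -> forall a : R, (u x < a%:E)%E ->
    \forall y \near within A (nbhs x), (u y < a%:E)%E.

(* [u] is upper semicontinuous with values in [-oo, +oo[ and subharmonic along
   complex lines; upper semicontinuity of the slices follows from that of [u].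
   The function -oo is allowed. *)
Definition psh (R : realType) (n : nat) (Omega : set 'rV[R]_(n + n))
    (u : 'rV[R]_(n + n) -> \bar R) : Prop :=
  [/\ forall x, Omega x -> (u x < +oo)%E,
      usc_on Omega u
    & forall a b : 'rV[R[i]]_n,
        submean [set zeta : R[i] | Omega (realify (a + zeta *: b))]
                (fun zeta => u (realify (a + zeta *: b)))].

Definition psh_near (R : realType) (n : nat) (K : set 'rV[R]_(n + n))
    (u : 'rV[R]_(n + n) -> \bar R) : Prop :=
  exists U : set 'rV[R]_(n + n), [/\ open U, K `<=` U & psh U u].

Definition iter_partial (R : realType) (m : nat) (s : seq 'I_m)
    (f : 'rV[R]_m -> R) : 'rV[R]_m -> R :=
  foldr (fun i g x => 'D_(delta_mx 0 i) g x) f s.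

Definition smooth_on (R : realType) (m : nat) (U : set 'rV[R]_m)
    (f : 'rV[R]_m -> R) : Prop :=
  forall (s : seq 'I_m) (x : 'rV[R]_m), U x ->
    {for x, continuous (iter_partial s f)} /\
    forall i : 'I_m, derivable (iter_partial s f) x (delta_mx 0 i).

Definition smooth_near (R : realType) (m : nat) (K : set 'rV[R]_m)
    (f : 'rV[R]_m -> R) : Prop :=
  exists U : set 'rV[R]_m, [/\ open U, K `<=` U & smooth_on U f].

(* Main.v *)
(** Near the closure of Omega, u is approximated by finitely many translates
    z |-> u (z + t w_j), where w_j is the inward direction at x_j (or 0 for an
    interior point x_j): for small t the translate is plurisubharmonic near the
    part of the closure that lies in a ball around x_j.  The translates are
    glued by the maximum
      g z = max_j (u (z + t w_j) + d (rho_j^2 - |z - x_j|^2 + |z|^2)).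
    The added terms are affine, hence pluriharmonic, and for small t an index
    with |z - x_j|^2 > 2 rho_j^2 never realizes the maximum at z.  Thus g
    satisfies the submean inequality on all small circles centred near the
    closure.  This survives convolution with a smooth kernel of small support,
    and by a maximum principle it extends from small circles to all discs. *)
Require Import Defs.
From mathcomp Require Import ring lra.

Set Implicit Arguments.
Unset Strict Implicit.
Unset Printing Implicit Defensive.

Local Open Scope classical_set_scope.
Local Open Scope ring_scope.

(** Along a C^0 boundary the inward direction exists only locally, so no single translate of u works
    near the whole closure, and patching translates with a partition of unity would destroy the
    submean inequality. A maximum preserves it, but needs a term deciding which translate may win
    where. The natural choice d (rho_j^2 - |z - x_j|^2) has the wrong sign of curvature. Adding d
    |z|^2 makes it affine; being common to all j, this changes no comparison between indices, and it
    costs at most d times the maximum of |z|^2 on the closure. To keep domains out of the analysis,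
    u is first extended continuously to the whole space. Every function integrated or convolved
    below is then continuous everywhere, and Omega enters only through the circles on which a
    submean inequality is known. After gluing these are circles of bounded radius centred near the
    closure, whereas [psh] tests every disc contained in the neighbourhood, hence the passage from
    small circles to all discs. *)

Section calculus.
Variable R : realType.
Implicit Types (a b c x y : R) (f g F : R -> R).

(** * One-variable integrals of continuous functions: antiderivatives, parameters, Fubini *)

Definition integ a b f : R := \int[lebesgue_measure]_(x in `[a, b]) f x.

Lemma cont_integrable a b f : continuous f ->
  (@lebesgue_measure R).-integrable `[a, b] (EFin \o f).
Proof.
move=> cf; apply: continuous_compact_integrable; first exact: segment_compact.
exact: continuous_subspaceT.
Qed.

Lemma integ_EFin a b f : continuous f ->
  (\int[lebesgue_measure]_(x in `[a, b]) (f x)%:E = (integ a b f)%:E)%E.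
Proof.
by move=> cf; rewrite fineK// integrable_fin_num//; exact: cont_integrable.
Qed.

Lemma eq_integ a b f g : (forall x, a <= x <= b -> f x = g x) ->
  integ a b f = integ a b g.
Proof.
by move=> fg; apply: eq_Rintegral => x; rewrite inE/= in_itv/= => /fg.
Qed.

Lemma integD a b f g : continuous f -> continuous g ->
  integ a b (fun x => f x + g x) = integ a b f + integ a b g.
Proof. by move=> cf cg; rewrite /integ RintegralD//; exact: cont_integrable. Qed.

Lemma integZ a b k f : continuous f ->
  integ a b (fun x => k * f x) = k * integ a b f.
Proof. by move=> cf; rewrite /integ RintegralZl//; exact: cont_integrable. Qed.

Lemma integ_cst a b k : a <= b -> integ a b (fun=> k) = k * (b - a).
Proof.
move=> ab; rewrite /integ Rintegral_cst//= lebesgue_measure_itv/= lte_fin.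
case: ltP => // ba; have -> : a = b by apply/eqP; rewrite eq_le ab ba.
by rewrite subrr.
Qed.

Lemma integ_gt a b f : b < a -> integ a b f = 0.
Proof.
by move=> ba; rewrite /integ set_itv_ge ?Rintegral_set0// bnd_simp -ltNge.
Qed.

Lemma le_integ a b f g : continuous f -> continuous g ->
  (forall x, a <= x <= b -> f x <= g x) -> integ a b f <= integ a b g.
Proof.
move=> cf cg fg; apply: le_Rintegral => //; try exact: cont_integrable.
Qed.

Lemma integ_chasles a b c f : continuous f -> a <= b -> b <= c ->
  integ a c f = integ a b f + integ b c f.
Proof.
move=> cf ab bc; apply/eqP; rewrite addrC -subr_eq; apply/eqP.
have ii := @cont_integrable a c f cf.
rewrite /integ Rintegral_itvB// ?bnd_simp//.
rewrite Rintegral_itv_obnd_cbnd; [by []|apply: integrableS ii => //].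
by apply: subset_itvr; rewrite bnd_simp.
Qed.

Lemma norm_integ_le a b f k : a <= b -> continuous f ->
  (forall x, a <= x <= b -> `|f x| <= k) -> `|integ a b f| <= k * (b - a).
Proof.
move=> ab cf fk; rewrite ler_norml -mulNr -!integ_cst//.
by apply/andP; split; apply: le_integ => //; try exact: cst_continuous;
  move=> x /fk; rewrite ler_norml => /andP[].
Qed.

Lemma FTC2 a b f F : a <= b -> continuous f ->
  (forall x, is_derive x 1 F (f x)) -> integ a b f = F b - F a.
Proof.
move=> ab cf dF; have [ba|ab'] := leP b a.
  have -> : a = b by apply/eqP; rewrite eq_le ab ba.
  by rewrite subrr /integ set_itv1 Rintegral_set1.
have cF : continuous F.
  by move=> x; apply: differentiable_continuous; apply/derivable1_diffP.
rewrite /integ /Rintegral (@continuous_FTC2 _ f F)//.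
- exact: continuous_subspaceT.
- split; first by move=> x _; have [] := dF x.
  + by apply: cvg_at_right_filter; exact: cF.
  + by apply: cvg_at_left_filter; exact: cF.
- by move=> x _; rewrite derive1E; exact: derive_val.
Qed.

(* At most one of the two terms is nonzero, since the integral over an empty
   interval is 0. *)
Definition prim f y : R := integ 0 y f - integ y 0 f.

Lemma primE N f y : continuous f -> N <= 0 -> N <= y ->
  prim f y = integ N y f - integ N 0 f.
Proof.
move=> cf N0 Ny; rewrite /prim; have [y0|y0] := ltP y 0.
  by rewrite integ_gt// (@integ_chasles N y 0)// ?(ltW y0)//; ring.
rewrite (@integ_chasles N 0 y)//.
move: y0; rewrite le_eqVlt => /predU1P[<-|/integ_gt ->].
  by rewrite /integ set_itv1 Rintegral_set1; ring.
by ring.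
Qed.

Lemma is_derive_prim f y : continuous f -> is_derive y 1 (prim f) (f y).
Proof.
(* The base point lies strictly below both 0 and [y], so that [y] is interior to the interval to
   which the fundamental theorem is applied. *)
move=> cf; pose N := - `|y| - 1.
have Ny : N < y by rewrite /N; have := lerNnormlW (lexx `|y|); lra.
have N0 : N < 0 by rewrite /N; have := normr_ge0 y; lra.
have : is_derive y 1 (fun y => integ N y f + (- integ N 0 f)) (f y).
  rewrite -[f y]addr0; apply: is_deriveD.
  have y1 : y < y + 1 by rewrite ltrDl.
  have [d1 d2] := @continuous_FTC1_closed _ f N y (y + 1) y1
    (@cont_integrable N (y + 1) f cf) Ny (cf y).
  by apply: (DeriveDef d1); rewrite -derive1E; exact: d2.
apply: near_eq_is_derive.
near=> z; rewrite (@primE N)// ?(ltW N0)//.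
by near: z; apply: (@cvgr_ge _ _ _ _ id y) => //; exact: cvg_id.
Unshelve. all: by end_near. Qed.


(** A tube argument: continuity at each [(x, s)] gives a product neighbourhood, and compactness of
    [K] makes the neighbourhood of [x] independent of [s]. *)
Lemma cont_near (T : topologicalType) (K : set T) (V : topologicalType)
    (F : V -> T -> R) (x : V) (e : R) : compact K ->
  continuous (fun p : V * T => F p.1 p.2) -> 0 < e ->
  \forall v \near x, forall s, K s -> `|F x s - F v s| < e.
Proof.
move=> cK cF e0.
move/compact_near_coveringP/(_ V (nbhs x) (fun v s => `|F x s - F v s| < e)) : cK.
apply=> s _.
have e20 : 0 < e / 2 by rewrite divr_gt0.
have := cF (x, s); move/cvgrPdist_lt => /(_ _ e20) /= [[A B]] /= [xA sB] AB.
exists (B, A) => //= -[s' x'] /= [Bs' Ax'].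
have h1 := AB (x', s') (conj Ax' Bs').
have h2 := AB (x, s') (conj (nbhs_singleton xA) Bs').
rewrite /= in h1 h2.
have -> : F x s' - F x' s' = (F x s - F x' s') - (F x s - F x s') by ring.
by rewrite (le_lt_trans (ler_normB _ _))// [ltRHS]splitr ltrD.
Qed.

Lemma cont_integ (V : topologicalType) (F : V -> R -> R) a b : a <= b ->
  continuous (fun p : V * R => F p.1 p.2) ->
  continuous (fun v => integ a b (F v)).
Proof.
move=> ab cF x; apply/cvgrPdist_le => e e0.
have cF1 v : continuous (F v).
  move=> s; apply: (@continuous_comp _ _ _ (fun s => (v, s))
    (fun p : V * R => F p.1 p.2)); last exact: cF.
  by apply: (@cvg_pair _ _ _ _ (nbhs v) (nbhs s)); [exact: cvg_cst|exact: cvg_id].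
(* The summand 1 keeps the denominator positive when [a = b]. *)
have e10 : 0 < e / (b - a + 1) by rewrite divr_gt0// ltr_pwDr// subr_ge0.
near=> v.
have -> : integ a b (F x) - integ a b (F v) =
    integ a b (fun s => F x s + (-1) * F v s).
  by rewrite integD ?integZ//; [ring|move=> s; apply: cvgM; [exact: cvg_cst|exact: cF1]].
rewrite (le_trans (@norm_integ_le a b _ (e / (b - a + 1)) _ _ _))//.
- by move=> s; apply: cvgD; [exact: cF1|apply: cvgM; [exact: cvg_cst|exact: cF1]].
- move=> s sab; rewrite mulN1r; apply: ltW; move: s sab.
  near: v; apply: filterS (cont_near x (@segment_compact _ a b) cF e10) => v h s sab.
  by apply: h; rewrite /= in_itv.
- by rewrite -mulrA ler_piMr ?(ltW e0)// mulrC ler_pdivrMr ?mul1r; lra.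
Unshelve. all: by end_near. Qed.

(** Joint continuity bounds [G] on the compact box [y - 1, y + 1] x [a, b], and this constant serves
    as the dominating function. *)
Lemma is_derive_integ (F G : R -> R -> R) a b y : a <= b ->
  (forall x, continuous (F x)) ->
  continuous (fun p : R * R => G p.1 p.2) ->
  (forall x s, is_derive x 1 (F ^~ s) (G x s)) ->
  is_derive y 1 (fun x => integ a b (F x)) (integ a b (G y)).
Proof.
move=> ab cF cG dF.
have [M M0 GM] : exists2 M, 0 <= M &
    forall x s, y - 1 < x < y + 1 -> a <= s <= b -> `|G x s| <= M.
  have cK : compact (`[y - 1, y + 1] `*` `[a, b] : set (R * R)).
    by apply: compact_setX; exact: segment_compact.
  have := continuous_compact (continuous_subspaceT cG) cK.
  move=> /compact_bounded[M [_ h]].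
  exists (`|M| + 1); first by rewrite addr_ge0.
  move=> x s /andP[x1 x2] sab; apply: (h (`|M| + 1)).
    by rewrite ltr_pwDr// ler_norm.
  exists (x, s) => //=; split; rewrite /= in_itv//=.
  by rewrite (ltW x1) (ltW x2).
have p1E x s : partial1of2 F x s = G x s.
  by rewrite partial1of2E; apply: derive_val.
have Iy : [set` `]y - 1, y + 1[] y by rewrite /= in_itv/=; lra.
have mab : measurable ([set` `[a, b]] : set R) by [].
have intF x : [set` `]y - 1, y + 1[] x ->
   (@lebesgue_measure R).-integrable `[a, b] (EFin \o F x).
  by move=> _; apply: cont_integrable; exact: cF.
have derF x s : [set` `]y - 1, y + 1[] x -> [set` `[a, b]] s -> derivable (F ^~ s) x 1.
  by move=> _ _; have [] := dF x s.
have intM : (@lebesgue_measure R).-integrable `[a, b] (EFin \o (fun=> M)).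
  by apply: cont_integrable => ?; exact: cvg_cst.
have ubG x s : [set` `]y - 1, y + 1[] x -> [set` `[a, b]] s ->
    `|partial1of2 F x s| <= M.
  by rewrite p1E /= !in_itv/= => xy sab; exact: GM.
have h2 := @derivable_under_integral R _ _ (@lebesgue_measure R) F _ mab
  _ _ _ Iy intF derF (fun=> M) (fun=> M0) intM ubG.
have h1 := @differentiation_under_integral R _ _ (@lebesgue_measure R) F _ mab
  _ _ _ Iy intF derF (fun=> M) (fun=> M0) intM ubG.
apply: DeriveDef => //.
rewrite derive1E in h1; rewrite [LHS]h1; apply: eq_integ => s _; exact: p1E.
Qed.

Lemma cont_pair1 (V W Z : topologicalType) (F : V -> W -> Z) (x : V) :
  continuous (fun p : V * W => F p.1 p.2) -> continuous (F x).
Proof.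
move=> cF s; apply: (@continuous_comp _ _ _ (fun s => (x, s))
  (fun p : V * W => F p.1 p.2)); last exact: cF.
by apply: (@cvg_pair _ _ _ _ (nbhs x) (nbhs s)); [exact: cvg_cst|exact: cvg_id].
Qed.

Lemma cont_pair_swap (V W Z : topologicalType) (F : V -> W -> Z) :
  continuous (fun p : V * W => F p.1 p.2) ->
  continuous (fun p : W * V => F p.2 p.1).
Proof.
move=> cF p; apply: (@continuous_comp _ _ _ (fun p : W * V => (p.2, p.1))
  (fun p : V * W => F p.1 p.2)); last exact: cF.
by apply: (@cvg_pair _ _ _ _ (nbhs p.2) (nbhs p.1)); [exact: cvg_snd|exact: cvg_fst].
Qed.

(* As functions of b, the two sides have the same derivative. *)
Lemma integ_fubini (F : R -> R -> R) a b c d : a <= b -> c <= d ->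
  continuous (fun p : R * R => F p.1 p.2) ->
  integ a b (fun s => integ c d (F s)) = integ c d (fun t => integ a b (F ^~ t)).
Proof.
move=> ab cd cF; have cF' := cont_pair_swap cF.
have cI := cont_integ cd cF.
have cFt t : continuous (F ^~ t) := @cont_pair1 _ _ _ (fun t s => F s t) t cF'.
pose K y := integ c d (fun t => prim (F ^~ t) y).
have cprim y : continuous (fun t => prim (F ^~ t) y).
  have [y0|y0] := leP 0 y.
    rewrite (_ : (fun _ => _) = fun t => integ 0 y (F ^~ t) - integ 0 0 (F ^~ t)).
      by move=> t; apply: cvgB; exact: (@cont_integ R (fun t s => F s t)).
    by apply/funext => t; rewrite (@primE 0).
  rewrite (_ : (fun _ => _) = fun t => integ y y (F ^~ t) - integ y 0 (F ^~ t)).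
    by move=> t; apply: cvgB; apply: (@cont_integ R (fun t s => F s t)) => //; exact: ltW.
  by apply/funext => t; rewrite (@primE y)// ltW.
have dK y : is_derive y 1 K (integ c d (F y)).
  by apply: (@is_derive_integ (fun y t => prim (F ^~ t) y)) => // x s;
    exact: is_derive_prim.
rewrite (FTC2 ab cI dK) /K.
transitivity (integ c d (fun t => prim (F ^~ t) b + (-1) * prim (F ^~ t) a)).
  have cN : continuous (fun t => (-1) * prim (F ^~ t) a).
    by move=> t; apply: cvgM; [exact: cvg_cst|exact: cprim].
  by rewrite (integD _ _ (cprim b) cN) (integZ _ _ _ (cprim a)) mulN1r.
apply: eq_integ => t _; rewrite mulN1r; apply/esym; apply: FTC2 => // x.
exact: is_derive_prim.
Qed.
End calculus.

(** * A smooth bump function with all its derivatives *)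

Section bump.
Variable R : realType.
Implicit Types (x y : R) (f g : R -> R) (P : {poly R}).

Lemma horner_bound P : exists S : R, exists N : nat,
  0 <= S /\ forall y, 1 <= y -> `|P.[y]| <= S * y ^+ N.
Proof.
elim/poly_ind: P => [|P c [S [N [S0 h]]]].
  by exists 0; exists 0%N; split=> // y _; rewrite horner0 normr0 mul0r.
exists (S + `|c|); exists N.+1; split; first by rewrite addr_ge0.
move=> y y1; rewrite !hornerE (le_trans (ler_normD _ _))// mulrDl lerD//.
  rewrite normrM (ger0_norm (_ : 0 <= y)) ?(le_trans ler01)//.
  by rewrite exprSr mulrA ler_wpM2r ?h// (le_trans ler01).
by rewrite ler_peMr// exprn_ege1.
Qed.

(** With the polynomial as a parameter, the functions P(1/x) exp(-1/x) form a family closed under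
    differentiation, so that smoothness needs no formula for higher derivatives. *)
Definition flat P x : R := if 0 < x then P.[x^-1] * expR (- x^-1) else 0.

(** With y = 1/x one has |P(y)| <= S y^N and exp y >= y^(N+2) / (N+2)!, so the quotient decays like
    y^-2. Quadratic decay at 0 forces the derivative there to vanish. *)
Lemma flat_bound P : exists2 C : R, 0 <= C &
  forall x, x <= 1 -> `|flat P x| <= C * x ^+ 2.
Proof.
have [S [N [S0 h]]] := horner_bound P.
exists (S * N.+2`!%:R); first by rewrite mulr_ge0.
move=> x x1; rewrite /flat; case: ifPn => x0; last first.
  by rewrite normr0; apply: mulr_ge0; [apply: mulr_ge0|exact: sqr_ge0].
have xi1 : 1 <= x^-1 by rewrite -[1]invr1 lef_pV2 ?posrE.
have xi0 : 0 < x^-1 by rewrite invr_gt0.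
rewrite normrM (ger0_norm (expR_ge0 _)) expRN.
have e1 : x^-1 ^+ N.+2 / N.+2`!%:R <= expR x^-1.
  by apply: le_trans (expR_ge1Dxn N.+1 (ltW xi0)); rewrite lerDr.
have e2 : 0 < x^-1 ^+ N.+2 / N.+2`!%:R by rewrite divr_gt0 ?exprn_gt0 ?ltr0n ?fact_gt0.
apply: (@le_trans _ _ ((S * x^-1 ^+ N) * (x^-1 ^+ N.+2 / N.+2`!%:R)^-1)).
  apply: ler_pM; [exact: normr_ge0|by rewrite invr_ge0 expR_ge0|exact: h|].
  by rewrite lef_pV2 ?posrE ?expR_gt0.
have -> : x^-1 ^+ N.+2 = x^-1 ^+ N / x ^+ 2 by rewrite -(addn2 N) exprD (exprVn _ 2).
have xN0 : x^-1 ^+ N != 0 by rewrite expf_neq0// gt_eqF.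
have fN0 : N.+2`!%:R != 0 :> R by rewrite pnatr_eq0 -lt0n fact_gt0.
have x20 : x ^+ 2 != 0 by rewrite expf_neq0// gt_eqF.
move: (x^-1 ^+ N) (x ^+ 2) (N.+2`!%:R) xN0 fN0 x20 => a b c a0 c0 b0.
rewrite le_eqVlt; apply/orP; left; apply/eqP; field.
by rewrite a0 b0 c0.
Qed.

Lemma is_derive_flat P x :
  is_derive x 1 (flat P) (flat ('X^2 * (P - P^`())) x).
Proof.
have [x0|x0|x0] := ltgtP x 0.
- rewrite {2}/flat ltNge (ltW x0)/=.
  have : is_derive x 1 (cst (0 : R)) 0 by exact: is_derive_cst.
  apply: near_eq_is_derive.
  near=> z; rewrite /flat /= ltNge (_ : z <= 0)//.
  by near: z; apply: (@cvgr_le _ _ _ _ id x) => //; exact: cvg_id.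
- rewrite {2}/flat x0 hornerM hornerXn hornerD hornerN exprVn.
  have xn0 : x != 0 by rewrite gt_eqF.
  have : is_derive x 1 ((horner P \o GRing.inv) * (expR \o (- (GRing.inv : R -> R))))
     (x ^- 2 * (P.[x^-1] - P^`().[x^-1]) * expR (- x^-1)).
    have dV : is_derive x 1 (GRing.inv : R -> R) (- x ^- 2).
      apply: DeriveDef; first exact: (@derivableV _ _ id).
      by rewrite (@deriveV _ _ id)// derive_id /GRing.scale/= mulr1.
    have d1 := is_derive1_comp (is_derive_poly P x^-1) dV.
    have d2 : is_derive x 1 (expR \o (- (GRing.inv : R -> R)))
        (expR (- x^-1) * - - x ^- 2).
      by apply: is_derive1_comp; exact: is_deriveN.
    apply: (is_derive_eq (is_deriveM d1 d2)); rewrite /GRing.scale/= /comp/=; ring.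
  apply: near_eq_is_derive.
  near=> z; rewrite /flat /= ifT//.
  by near: z; apply: (@cvgr_gt _ _ _ _ id x) => //; exact: cvg_id.
- rewrite x0; have f0 Q : flat Q 0 = 0 by rewrite /flat ltxx.
  rewrite f0; have [C C0 hC] := flat_bound P.
  suff h : h^-1 *: (flat P (h *: 1 + 0) - flat P 0) @[h --> 0^'] --> (0 : R).
    apply: DeriveDef; first by apply/cvg_ex; exists 0.
    exact: cvg_lim.
  apply/cvgrPdist_le => e e0; near=> h.
  rewrite f0 sub0r normrN subr0 addr0 /GRing.scale/= mulr1 normrM normfV.
  have h0 : h != 0 by near: h; exact: nbhs_dnbhs_neq.
  rewrite ler_pdivrMl ?normr_gt0//.
  have hh : `|h| <= Num.min 1 (e / (C + 1)).
    near: h; apply: dnbhs0_le.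
    by rewrite lt_min ltr01 divr_gt0// ltr_pwDr.
  move: hh; rewrite le_min => /andP[h1 h2].
  rewrite (le_trans (hC _ (le_trans (ler_norm _) h1)))//.
  rewrite -real_normK ?num_real// expr2 mulrCA ler_wpM2l//.
  move: h2; rewrite ler_pdivlMr ?ltr_pwDr// => h2.
  by apply: le_trans h2; rewrite mulrC ler_wpM2l//; lra.
Unshelve. all: by end_near. Qed.

(** Asking for some derivative at each level, instead of naming iterated derivatives, makes
    stability under sums, products and affine substitutions a plain induction. *)
Fixpoint Cn (n : nat) f : Prop :=
  if n is n'.+1 then exists2 f', (forall x, is_derive x 1 f (f' x)) & Cn n' f'
  else True.

Lemma Cn_flat n P : Cn n (flat P).
Proof.
elim: n P => //= n ih P; exists (flat ('X^2 * (P - P^`()))) => //.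
exact: is_derive_flat.
Qed.

Lemma CnS n f : Cn n.+1 f -> Cn n f.
Proof.
elim: n f => // n ih f [f' df cf']; exists f' => //; exact: ih.
Qed.

Lemma CnD n f g : Cn n f -> Cn n g -> Cn n (f + g).
Proof.
elim: n f g => //= n ih f g [f' df cf] [g' dg cg]; exists (f' + g'); last exact: ih.
by move=> x; apply: is_deriveD.
Qed.

Lemma CnM n f g : Cn n f -> Cn n g -> Cn n (f * g).
Proof.
elim: n f g => // n ih f g cf cg.
have [f' df cf'] := cf; have [g' dg cg'] := cg.
exists (f * g' + g * f'); last by apply: CnD; apply: ih => //; exact: CnS.
by move=> x; apply: is_deriveM.
Qed.

Lemma Cn_affine n f (a b : R) : Cn n f -> Cn n (fun x => f (a * x + b)).
Proof.
elim: n f => // n ih f [f' df cf].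
exists (fun x => a * f' (a * x + b)); last first.
  have ca : Cn n (fun=> a : R).
    clear; elim: n a => //= n ih a; exists (fun=> 0); last exact: ih.
    by move=> x; exact: is_derive_cst.
  exact: (CnM ca (ih _ cf)).
move=> x; have dg : is_derive x 1 (fun x => a * x + b) a.
  apply: (is_derive_eq (is_deriveD (is_deriveZ a (is_derive_id x 1))
    (is_derive_cst b x 1))).
  by rewrite addr0 /GRing.scale/= mulr1.
by rewrite mulrC; exact: (@is_derive1_comp _ f (fun x => a * x + b)).
Qed.

Lemma Cn_iterates f : (forall n, Cn n f) ->
  exists2 F : nat -> R -> R, F 0%N = f & forall n x, is_derive x 1 (F n) (F n.+1 x).
Proof.
move=> cf; exists (fun n => derive1n n f); [by []|move=> n x].
have : Cn 1 (derive1n n f).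
  have : forall k, Cn k (derive1n n f).
    elim: n f cf => // n ih f cf k; rewrite derive1Sn; apply: ih => {}k.
    have [f' df] := cf k.+1; rewrite (_ : f' = (f^`())%classic)//.
    by apply/funext => y; rewrite derive1E; apply/esym; apply: derive_val.
  exact.
move=> [f' df _]; rewrite derive1nS; apply: DeriveDef; first by have [] := df x.
by rewrite derive1E.
Qed.

Lemma smooth_bump (h : R) : 0 < h -> exists k : nat -> R -> R,
  [/\ forall i x, is_derive x 1 (k i) (k i.+1 x),
      forall i x, h <= `|x| -> k i x = 0,
      forall x, 0 <= k 0%N x & integ (- h) h (k 0%N) = 1].
Proof.
(* Since a h = 2, the product below is supported in |x| <= h/2. Each derivative then vanishes on the
   open set |x| > h/2, because the previous one is locally 0 there; the margin covers the endpoints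
   |x| = h. *)
move=> h0; pose a := 2 / h; have a0 : 0 < a by rewrite divr_gt0.
have ah : a * h = 2 by rewrite /a mulfVK// gt_eqF.
pose f : R -> R := flat 1;
  pose g := (fun x => f (a * x + 1)) * (fun x => f (- a * x + 1)).
have gE x : g x = f (a * x + 1) * f (- a * x + 1) by [].
have f_ge0 x : 0 <= f x.
  by rewrite /f /flat; case: ifP => // _; rewrite hornerC mul1r expR_ge0.
have cg n : Cn n g by apply: CnM; apply: Cn_affine; exact: Cn_flat.
have [F F0 dF] := Cn_iterates cg.
have Fsupp i x : h / 2 < `|x| -> F i x = 0.
  elim: i x => [|i ih] x x2.
    rewrite F0 gE /f /flat.
    case: ifPn => h1; last by rewrite mul0r.
    case: ifPn => h2; last by rewrite mulr0.
    exfalso; move: x2; rewrite ltNge => /negP; apply.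
    rewrite -(ler_pM2l a0) mulrA ah divff ?pnatr_eq0// -(gtr0_norm a0) -normrM.
    by rewrite ler_norml; apply/andP; split; lra.
  rewrite -(@derive_val _ _ _ _ _ _ _ (dF i x)).
  have : is_derive x 1 (cst (0 : R)) 0 by exact: is_derive_cst.
  move=> d0; have := @near_eq_is_derive _ _ _ (cst 0) (F i) x 1 0 _ d0.
  case; last by move=> _ ->.
  near=> z; rewrite ih//; near: z.
  have := @norm_continuous _ R x; move/cvgr_gt; exact.
have cF i : continuous (F i).
  by move=> x; apply: differentiable_continuous; apply/derivable1_diffP;
    have [] := dF i x.
have F_ge0 x : 0 <= F 0%N x by rewrite F0 gE mulr_ge0.
(* The function is nonnegative and stays above half its value at 0 on a short interval [0, r]. *)
have If : 0 < integ (- h) h (F 0%N).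
  have g0 : 0 < F 0%N 0.
    by rewrite F0 gE !mulr0 add0r /f /flat ltr01 hornerC mul1r mulr_gt0// expR_gt0.
  have : \forall z \near (0 : R), F 0%N 0 / 2 <= F 0%N z.
    have := cF 0%N 0; move/cvgr_ge; apply; lra.
  move=> /nbhs_ballP[d /= d0 hd].
  pose r := Num.min (d / 2) h.
  have r0 : 0 < r by rewrite lt_min h0 divr_gt0.
  have r1 : r <= h by rewrite ge_min lexx orbT.
  have rd : r < d by rewrite gt_min; apply/orP; left; lra.
  rewrite (@integ_chasles _ _ 0) ?oppr_le0 ?(ltW h0)//.
  rewrite (@integ_chasles _ 0 r)//; last exact: ltW.
  have i0 p q : 0 <= integ p q (F 0%N) by apply: Rintegral_ge0.
  have : 0 < integ 0 r (F 0%N).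
    apply: (@lt_le_trans _ _ (integ 0 r (fun=> F 0%N 0 / 2))).
      by rewrite integ_cst ?(ltW r0)// subr0 mulr_gt0// divr_gt0.
    apply: le_integ => // [?|z /andP[z0 zr]]; first exact: cvg_cst.
    by apply: hd; rewrite /ball/= sub0r normrN ger0_norm// (le_lt_trans zr).
  by have := i0 (- h) 0; have := i0 r h; lra.
pose c := (integ (- h) h (F 0%N))^-1.
exists (fun i x => c * F i x); split.
- by move=> i x; exact: (is_deriveZ c (dF i x)).
- move=> i x x1; rewrite Fsupp ?mulr0// (lt_le_trans _ x1)// gtr_pMr// invf_lt1 ?ltr1n//.
- by move=> x; rewrite mulr_ge0// invr_ge0 ltW.
- by rewrite integZ ?mulVf// gt_eqF.
Unshelve. all: by end_near. Qed.

End bump.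

(** * Directional derivatives as one-variable derivatives *)

Section directional.
Variables (R : realType) (V : normedModType R).
Implicit Types (f : V -> R) (x v : V).

Let line_quotient f x v (h : R) :
  h^-1 *: (((fun y : R => f (y *: v + x)) \o shift 0) (h *: 1) - f (0 *: v + x))
  = h^-1 *: ((f \o shift x) (h *: v) - f x).
Proof. by rewrite /= addr0 scale0r add0r -[h *: 1]/(h * 1) mulr1. Qed.

Lemma is_derive_line0 f x v (d : R) :
  is_derive x v f d <-> is_derive (0 : R) 1 (fun y : R => f (y *: v + x)) d.
Proof.
have E := funext (line_quotient f x v).
split=> -[dv de]; apply: DeriveDef.
- by move: dv; rewrite /derivable -E.
- by move: de; rewrite /derive -E.
- by move: dv; rewrite /derivable E.
- by move: de; rewrite /derive E.
Qed.

Lemma is_derive_line f x v (d : R) (y : R) : is_derive (y *: v + x) v f d ->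
  is_derive y 1 (fun y : R => f (y *: v + x)) d.
Proof.
move=> /is_derive_line0 h.
have dg : is_derive y 1 ((@id R) - cst y) 1.
  by apply: (is_derive_eq (is_deriveB (is_derive_id y 1) (is_derive_cst y y 1)));
    rewrite subr0.
have : is_derive (((@id R) - cst y) y) 1
    (fun t : R => f (t *: v + (y *: v + x))) d.
  by rewrite (_ : (id - cst y) y = 0)//; exact: subrr.
move=> h'; have := is_derive1_comp h' dg; rewrite mulr1.
rewrite (_ : _ \o _ = fun y : R => f (y *: v + x))//.
by apply/funext => z /=; rewrite addrA -scalerDl; congr (f (_ *: _ + _)); exact: subrK.
Qed.

End directional.

(** * Convolution along a single direction *)

Section smoothing.
Variables (R : realType) (V : normedModType R) (h : R).
Hypothesis h0 : 0 < h.
Implicit Types (f g : V -> R) (x v : V) (k : R -> R).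

Definition convol k v f x : R := integ (- h) h (fun s => k s * f (x - s *: v)).

Let hh : - h <= h. Proof. by rewrite ge0_cp// ltW. Qed.

Lemma cont_convol_integrand k v f : continuous k -> continuous f ->
  continuous (fun p : V * R => k p.2 * f (p.1 - p.2 *: v)).
Proof.
move=> ck cf p; apply: cvgM.
  by apply: (@continuous_comp _ _ _ snd k); [exact: cvg_snd|exact: ck].
apply: (@continuous_comp _ _ _ (fun p : V * R => p.1 - p.2 *: v) f); last exact: cf.
by apply: cvgB; [exact: cvg_fst|apply: cvgZr_tmp; exact: cvg_snd].
Qed.

Lemma cont_convol k v f : continuous k -> continuous f ->
  continuous (convol k v f).
Proof.
move=> ck cf; apply: (@cont_integ _ V (fun x s => k s * f (x - s *: v))) => //.
exact: cont_convol_integrand.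
Qed.

Lemma cont_integrand k v f x : continuous k -> continuous f ->
  continuous (fun s : R => k s * f (x - s *: v)).
Proof.
move=> ck cf; apply: (cont_pair1 (F := fun x s => k s * f (x - s *: v))).
exact: cont_convol_integrand.
Qed.

Lemma convol_close k v f x (c eta : R) : continuous k -> continuous f ->
  (forall s, 0 <= k s) -> integ (- h) h k = 1 ->
  (forall s, `|s| <= h -> `|f (x - s *: v) - c| <= eta) ->
  `|convol k v f x - c| <= eta.
Proof.
move=> ck cf k0 k1 fc.
have ckc a : continuous (fun s => a * k s).
  by move=> s; apply: cvgM; [exact: cvg_cst|exact: ck].
have kc a : integ (- h) h (fun s => a * k s) = a by rewrite integZ// k1 mulr1.
have bnd s : - h <= s <= h -> c - eta <= f (x - s *: v) <= c + eta.
  by rewrite -ler_norml => /fc; rewrite ler_norml; lra.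
rewrite ler_norml lerBrDr lerBlDr addrC [eta + _]addrC.
rewrite -[leLHS]kc -[X in _ && (_ <= X)]kc; apply/andP; split;
  apply: le_integ => //; try exact: cont_integrand; move=> s /bnd /andP[b1 b2];
  by rewrite [_ * k s]mulrC ler_wpM2l.
Qed.

(** The derivative falls on [f]; this is used for coordinate directions other than that of the
    kernel. *)
Lemma is_derive_convol k v w f g x : continuous k -> continuous f ->
  continuous g -> (forall x, is_derive x w f (g x)) ->
  is_derive x w (convol k v f) (convol k v g x).
Proof.
move=> ck cf cg df; apply/is_derive_line0.
rewrite (_ : convol k v g x = convol k v g (0 *: w + x)); last first.
  by rewrite scale0r add0r.
have cl (u : V -> R) : continuous u ->
    continuous (fun p : R * R => k p.2 * u (p.1 *: w + x - p.2 *: v)).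
  move=> cu p; apply: cvgM.
    by apply: (@continuous_comp _ _ _ snd k); [exact: cvg_snd|exact: ck].
  apply: (@continuous_comp _ _ _ (fun p : R * R => p.1 *: w + x - p.2 *: v) u);
    last exact: cu.
  apply: cvgB; last by apply: cvgZr_tmp; exact: cvg_snd.
  by apply: cvgD; [apply: cvgZr_tmp; exact: cvg_fst|exact: cvg_cst].
apply: (@is_derive_integ _ (fun y s => k s * f (y *: w + x - s *: v))
  (fun y s => k s * g (y *: w + x - s *: v))) => //.
- by move=> y; apply: cont_integrand.
- exact: cl.
- move=> y s.
  have : is_derive y 1 (fun y : R => f (y *: w + (x - s *: v)))
    (g (y *: w + (x - s *: v))).
    exact: is_derive_line.
  move=> /(is_deriveZ (k s)); rewrite addrA.
  rewrite (_ : _ \*: _ = (fun y : R => k s * f (y *: w + x - s *: v)))//.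
  by apply/funext => z; rewrite -addrA.
Qed.

(** The substitution r = y - s moves [y] from [phi], which is only continuous, into the kernel. For
    |y| <= h the kernel lives on |r| <= 2h, so the new domain does not depend on [y] and one can
    differentiate under the integral. Both sides are increments of the antiderivative [P] over
    [y - 2h, y + 2h], where the parts outside [-h, h] contribute 0. *)
Lemma convol_shift k (phi : R -> R) (y : R) : continuous k -> continuous phi ->
  (forall s, h <= `|s| -> k s = 0) -> `|y| <= h ->
  integ (- h) h (fun s => k s * phi (y - s)) =
  integ (- (2 * h)) (2 * h) (fun r => k (y - r) * phi r).
Proof.
move=> ck cphi k0 yh.
have cid' : continuous (fun r : R => y - r).
  by move=> r; apply: cvgB; [exact: cvg_cst|exact: cvg_id].
have c1 : continuous (fun s => k s * phi (y - s)).
  move=> s; apply: cvgM; first exact: ck.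
  by apply: (continuous_comp (cid' s)); exact: cphi.
have c2 : continuous (fun r => k (y - r) * phi r).
  move=> s; apply: cvgM; last exact: cphi.
  by apply: (continuous_comp (cid' s)); exact: ck.
move: (yh); rewrite ler_norml => /andP[y1 y2].
set P := prim (fun s => k s * phi (y - s)).
have dP (z : R) : is_derive z 1 P (k z * phi (y - z)) by exact: is_derive_prim.
have dQ (r : R) : is_derive r 1 (- (P \o (fun r => y - r))) (k (y - r) * phi r).
  have dg : is_derive r 1 (fun r : R => y - r) (-1).
    by apply: (is_derive_eq (is_deriveB (is_derive_cst y r 1) (is_derive_id r 1)));
      rewrite sub0r.
  have d1 : is_derive r 1 (P \o (fun r => y - r))
      (k (y - r) * phi (y - (y - r)) * -1) by exact: is_derive1_comp.
  apply: (is_derive_eq (is_deriveN d1)).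
  by rewrite mulrN1 opprK; congr (_ * phi _); ring.
have l0 : - (2 * h) <= 2 * h by have := h0; lra.
rewrite (FTC2 l0 c2 dQ) -[RHS]/(- P (y - 2 * h) - - P (y - - (2 * h))).
have l1 : y - 2 * h <= y + 2 * h by lra.
transitivity (P (y + 2 * h) - P (y - 2 * h)); last by rewrite !opprK addrC.
rewrite -(FTC2 l1 c1 dP) (@integ_chasles _ (y - 2 * h) (- h) (y + 2 * h));
  [|done|lra|lra].
rewrite (@integ_chasles _ (- h) h (y + 2 * h)); [|done|done|lra].
have z0 a b : a <= b -> (forall s, a <= s <= b -> k s = 0) ->
    integ a b (fun s => k s * phi (y - s)) = 0.
  move=> ab kz; rewrite (@eq_integ _ _ _ _ (fun=> 0)) ?integ_cst ?mul0r//.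
  by move=> s /kz ->; rewrite mul0r.
rewrite (z0 (y - 2 * h)) ?(z0 h) ?add0r ?addr0//; [lra| |lra|].
- by move=> s /andP[s1 _]; apply: k0; rewrite (le_trans s1)// ler_norm.
- move=> s /andP[_ s1]; apply: k0; rewrite -normrN; apply: le_trans (ler_norm _); lra.
Qed.

(** Here the derivative falls on the kernel, so continuity of [f] is enough. The shifted formula
    holds for |y| <= h, which suffices for a derivative at y = 0. *)
Lemma is_derive_convol_kernel k k' v f x : continuous k' -> continuous f ->
  (forall s : R, is_derive s 1 k (k' s)) ->
  (forall s, h <= `|s| -> k s = 0) -> (forall s, h <= `|s| -> k' s = 0) ->
  is_derive x v (convol k v f) (convol k' v f x).
Proof.
move=> ck' cf dk k0 k'0; apply/is_derive_line0.
have ck : continuous k.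
  by move=> s; apply: differentiable_continuous; apply/derivable1_diffP;
    have [] := dk s.
pose phi r := f (r *: v + x).
have cphi : continuous phi.
  move=> r; apply: continuous_comp; last exact: cf.
  by apply: cvgD; [apply: cvgZr_tmp; exact: cvg_id|exact: cvg_cst].
have E u (y : R) : continuous u -> (forall s, h <= `|s| -> u s = 0) ->
   `|y| <= h -> convol u v f (y *: v + x) =
   integ (- (2 * h)) (2 * h) (fun r => u (y - r) * phi r).
  move=> cu u0 yh; rewrite -convol_shift//; apply: eq_integ => s _.
  by congr (_ * f _); rewrite scalerBl addrAC.
rewrite -[convol k' v f x](_ : convol k' v f (0 *: v + x) = _); last first.
  by rewrite scale0r add0r.
rewrite E ?normr0 ?(ltW h0)//.
have cB : continuous (fun p : R * R => p.1 - p.2).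
  by move=> p; apply: cvgB; [exact: cvg_fst|exact: cvg_snd].
have l0 : - (2 * h) <= 2 * h by have := h0; lra.
have : is_derive (0 : R) 1 (fun y => integ (- (2 * h)) (2 * h) (fun r => k (y - r) * phi r))
  (integ (- (2 * h)) (2 * h) (fun r => k' (0 - r) * phi r)).
  apply: (@is_derive_integ _ (fun y r => k (y - r) * phi r)
    (fun y r => k' (y - r) * phi r)) => //.
  - move=> y r; apply: cvgM; last exact: cphi.
    apply: (@continuous_comp _ _ _ (fun r => y - r) k); last exact: ck.
    by apply: cvgB; [exact: cvg_cst|exact: cvg_id].
  - move=> p; apply: cvgM.
      by apply: (@continuous_comp _ _ _ (fun p : R * R => p.1 - p.2) k');
        [exact: cB|exact: ck'].
    by apply: (@continuous_comp _ _ _ snd phi); [exact: cvg_snd|exact: cphi].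
  - move=> y r.
    have dg : is_derive y 1 (fun y : R => y - r) 1.
      by apply: (is_derive_eq (is_deriveB (is_derive_id y 1) (is_derive_cst r y 1)));
        rewrite subr0.
    have d1 : is_derive y 1 (k \o (fun y => y - r)) (k' (y - r) * 1).
      exact: is_derive1_comp.
    have := is_deriveZ (phi r) d1.
    rewrite mulr1 -[_ *: _]/(phi r * k' (y - r)) mulrC.
    rewrite (_ : _ \*: _ = (fun y : R => k (y - r) * phi r))//.
    by apply/funext => z; rewrite mulrC.
apply: near_eq_is_derive; near=> y; rewrite E//.
Unshelve. all: end_near. Qed.

End smoothing.

(** * Mollification, one coordinate at a time *)

Section mollify.
Variables (R : realType) (m : nat) (h : R) (k : nat -> R -> R).
Hypothesis h0 : 0 < h.
Hypothesis dk : forall i (x : R), is_derive x 1 (k i) (k i.+1 x).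
Hypothesis k_supp : forall i (x : R), h <= `|x| -> k i x = 0.
Hypothesis k_ge0 : forall x : R, 0 <= k 0%N x.
Hypothesis k_int : integ (- h) h (k 0%N) = 1.
Implicit Types (f g : 'rV[R]_m -> R) (x : 'rV[R]_m) (al : 'I_m -> nat).

Lemma cont_kernel i : continuous (k i).
Proof.
by move=> s; apply: differentiable_continuous; apply/derivable1_diffP;
  have [] := dk i s.
Qed.

(* One-dimensional convolutions in the coordinates listed in [l]; the kernel
   used in the coordinate [i] is the [al i]-th derivative of [k 0]. *)
Fixpoint mollify al (l : seq 'I_m) f : 'rV[R]_m -> R :=
  if l is i :: l' then convol h (k (al i)) (delta_mx 0 i) (mollify al l' f)
  else f.

Lemma cont_mollify al l f : continuous f -> continuous (mollify al l f).
Proof.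
by move=> cf; elim: l => //= i l ih; apply: cont_convol => //; exact: cont_kernel.
Qed.

Lemma eq_mollify al al' l f : {in l, al =1 al'} ->
  mollify al l f = mollify al' l f.
Proof.
elim: l => //= i l ih e; rewrite e ?mem_head// ih// => j jl.
by apply: e; rewrite inE jl orbT.
Qed.

Definition incr al i := fun j => (al j + (j == i))%N.

(** The derivative passes through the convolutions in other coordinates until it meets the kernel in
    the coordinate [i], which absorbs it. As [l] has no repetition, the orders used after that
    kernel are unchanged. *)
Lemma is_derive_mollify al l f i x : continuous f -> uniq l -> i \in l ->
  is_derive x (delta_mx 0 i) (mollify al l f) (mollify (incr al i) l f x).
Proof.
move=> cf; elim: l x => //= j l ih x /andP[jl ul]; rewrite inE => ijl.
have [ij|ij] := eqVneq i j.
  have -> : mollify (incr al i) l f = mollify al l f.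
    apply: eq_mollify => a al'; rewrite /incr; case: eqVneq => [ai|_].
      by rewrite -ij -ai al' in jl.
    by rewrite addn0.
  rewrite -ij /incr eqxx addn1; apply: is_derive_convol_kernel => //.
  - exact: cont_kernel.
  - exact: cont_mollify.
  - exact: k_supp.
  - exact: k_supp.
rewrite /incr eq_sym (negbTE ij) addn0 -/(incr al i).
rewrite (negbTE ij) /= in ijl.
apply: is_derive_convol => //; try exact: cont_mollify; first exact: cont_kernel.
by move=> y; exact: ih.
Qed.

(** Every iterated partial derivative is again a mollification of the same continuous [f], with
    other orders; smoothness thus reduces to one derivative of [mollify]. *)
Lemma iter_partial_mollify al l f s : continuous f -> uniq l ->
  (forall i, i \in l) -> exists al', iter_partial s (mollify al l f) = mollify al' l f.
Proof.
move=> cf ul li; elim: s => [|i s [al' IH]]; first by exists al.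
exists (incr al' i); rewrite /= -/(iter_partial s _) IH.
by apply/funext => x; apply: derive_val; exact: is_derive_mollify.
Qed.

Lemma smooth_mollify al l f U : continuous f -> uniq l -> (forall i, i \in l) ->
  smooth_on U (mollify al l f).
Proof.
move=> cf ul li s x _; have [al' ->] := iter_partial_mollify al s cf ul li.
split; first exact: cont_mollify.
by move=> i; have [] := is_derive_mollify al' x cf ul (li i).
Qed.

Lemma norm_delta (i : 'I_m) : `|delta_mx 0 i : 'rV[R]_m| <= 1.
Proof.
rewrite [leLHS]/Num.Def.normr/= mx_normrE; apply/bigmax_leP; split=> // -[a b] _ /=.
by rewrite mxE; case: andP => _; rewrite ?normr0 ?normr1.
Qed.

(** Each convolution averages over points displaced by at most [h] in the sup norm, so [size l] of
    them reach no further than [size l] times [h]. *)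
Lemma mollify_close l f x (c eta : R) : continuous f ->
  (forall y, `|y - x| <= (size l)%:R * h -> `|f y - c| <= eta) ->
  `|mollify (fun=> 0%N) l f x - c| <= eta.
Proof.
move=> cf; elim: l x => [|i l ih] x fc /=.
  by apply: fc; rewrite subrr normr0 mul0r.
apply: convol_close => //; [exact: cont_kernel|exact: cont_mollify|].
move=> s sh; apply: ih => y yl; apply: fc.
rewrite -(subrK (x - s *: delta_mx 0 i) y) -addrA (le_trans (ler_normD _ _))//.
rewrite /= -[in leRHS]addn1 natrD mulrDl mul1r lerD//.
rewrite addrAC subrr add0r normrN normrZ -[leRHS]mulr1.
by apply: ler_pM => //; exact: norm_delta.
Qed.

End mollify.

(** * Circles in complex lines, written in real coordinates *)

Section realify.
Variables (R : realType) (n : nat).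
Implicit Types (p X : 'rV[R]_(n + n)) (f u v : 'rV[R]_(n + n) -> R).

(* Multiplication by the imaginary unit, transported by [realify]. *)
Definition rotJ X : 'rV[R]_(n + n) := row_mx (- rsubmx X) (lsubmx X).

Lemma rotJD X Y : rotJ (X + Y) = rotJ X + rotJ Y.
Proof. by rewrite /rotJ !linearD add_row_mx. Qed.

Lemma rotJZ (a : R) X : rotJ (a *: X) = a *: rotJ X.
Proof. by rewrite /rotJ !linearZ scale_row_mx. Qed.

Lemma rotJK X : rotJ (rotJ X) = - X.
Proof.
by rewrite /rotJ row_mxKr row_mxKl -[in RHS](hsubmxK X) opp_row_mx.
Qed.

Lemma rV_norm_leP (m : nat) (x : 'rV[R]_m) (e : R) : 0 <= e ->
  `|x| <= e <-> forall i, `|x 0 i| <= e.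
Proof.
move=> e0; rewrite [in X in X <-> _]/Num.Def.normr/= mx_normrE; split.
  by move=> /bigmax_leP[_ h] i; exact: (h (0, i)).
by move=> h; apply/bigmax_leP; split=> // -[i j] _; rewrite /= ord1.
Qed.

Lemma norm_rotJ X : `|rotJ X| <= `|X|.
Proof.
apply/rV_norm_leP => // i; rewrite mxE; case: splitP => j ij; rewrite !mxE ?normrN;
  exact: (rV_norm_leP X (normr_ge0 X)).1.
Qed.

Lemma realify_surj p : exists a : 'rV[R[i]]_n, realify a = p.
Proof.
exists (\row_j (p 0 (lshift n j) +i* p 0 (rshift n j))%C).
rewrite /realify -[RHS]hsubmxK; congr row_mx; apply/rowP => j; by rewrite !mxE.
Qed.

Lemma realify_line (a b : 'rV[R[i]]_n) (z : R[i]) :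
  realify (a + z *: b) =
  realify a + complex.Re z *: realify b + complex.Im z *: rotJ (realify b).
Proof.
rewrite /realify /rotJ row_mxKr row_mxKl !scale_row_mx !add_row_mx; case: z => x y /=.
by congr row_mx; apply/rowP => j; rewrite !mxE;
  case: (a 0 j) (b 0 j) => [a1 a2] [b1 b2] /=; ring.
Qed.

Definition circ p X (t : R) := p + cos t *: X + sin t *: rotJ X.

Definition mean (g : R -> R) : R := (2 * pi)^-1 * integ 0 (2 * pi) g.

Definition disc_in (A : set 'rV[R]_(n + n)) p X :=
  forall a b : R, a ^+ 2 + b ^+ 2 <= 1 -> A (p + a *: X + b *: rotJ X).

Definition circ_submean f p X := f p <= mean (fun t => f (circ p X t)).

Lemma circ_disc A p X t : disc_in A p X -> A (circ p X t).
Proof. by apply; rewrite cos2Dsin2. Qed.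

Lemma cont_circ p X : continuous (circ p X).
Proof.
move=> t; apply: cvgD; last by apply: cvgZr_tmp; exact: continuous_sin.
by apply: cvgD; [exact: cvg_cst|apply: cvgZr_tmp; exact: continuous_cos].
Qed.

Lemma cont_comp_circ f p X : continuous f -> continuous (fun t => f (circ p X t)).
Proof. by move=> cf t; apply: continuous_comp; [exact: cont_circ|exact: cf]. Qed.

Lemma pi2_ge0 : 0 <= 2 * pi :> R.
Proof. by rewrite mulr_ge0// pi_ge0. Qed.

Lemma mean_cst (c : R) : mean (fun=> c) = c.
Proof.
rewrite /mean integ_cst ?pi2_ge0// subr0 mulrC mulfK//.
by rewrite mulf_neq0// gt_eqF// pi_gt0.
Qed.

Lemma le_mean (g1 g2 : R -> R) : continuous g1 -> continuous g2 ->
  (forall t, g1 t <= g2 t) -> mean g1 <= mean g2.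
Proof.
move=> c1 c2 h; rewrite ler_wpM2l ?invr_ge0 ?pi2_ge0//.
by apply: le_integ => // t _; exact: h.
Qed.

Lemma meanD (g1 g2 : R -> R) : continuous g1 -> continuous g2 ->
  mean (fun t => g1 t + g2 t) = mean g1 + mean g2.
Proof. by move=> c1 c2; rewrite /mean integD// mulrDr. Qed.

Lemma meanZ (c : R) (g : R -> R) : continuous g ->
  mean (fun t => c * g t) = c * mean g.
Proof. by move=> cg; rewrite /mean integZ// mulrCA. Qed.

Lemma mean_cos : mean cos = 0.
Proof.
by rewrite /mean (@FTC2 _ _ _ _ sin) ?pi2_ge0 ?sin0//;
  [rewrite mulr_natl sin2pi subr0 mulr0|exact: continuous_cos].
Qed.

Lemma mean_sin : mean sin = 0.
Proof.
have dC (t : R) : is_derive t 1 (- cos) (sin t).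
  by apply: (is_derive_eq (is_deriveN (is_derive_cos t))); rewrite opprK.
rewrite /mean (FTC2 pi2_ge0 (@continuous_sin R) dC).
rewrite -[(- cos) _]/(- cos (2 * pi)) -[(- cos) 0]/(- cos 0) cos0 mulr_natl cos2pi.
by rewrite subrr mulr0.
Qed.

(** Centre 0 and radius 1 suffice in the slice: [p] and [X] absorb the centre and the radius. The
    whole disc lies in [Omega], so [u] may be replaced by its extension [f] on the circle. *)
Lemma psh_circ_submean Omega u f p X : psh Omega (EFin \o u) ->
  continuous f -> (forall x, Omega x -> u x = f x) -> disc_in Omega p X ->
  circ_submean f p X.
Proof.
move=> [_ _ sm] cf uf dO.
have [a ap] := realify_surj p; have [b bX] := realify_surj X.
have Op : Omega p.
  by have := dO 0 0; rewrite !scale0r !addr0; apply; rewrite expr0n/= addr0 ler01.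
have := sm a b 0 1 ltr01.
rewrite /= scale0r addr0 ap uf//.
have E t : realify (a + circle_pt 0 1 t *: b) = circ p X t.
  by rewrite realify_line ap bX /circle_pt add0r rmorph1 mul1r.
under eq_integral do rewrite E.
have -> : (\int[lebesgue_measure]_(t in `[0%R, (2 * pi)%R]) (u (circ p X t))%:E =
   \int[lebesgue_measure]_(t in `[0%R, (2 * pi)%R]) (f (circ p X t))%:E)%E.
  by apply: eq_integral => t _; rewrite uf//; exact: circ_disc.
rewrite (integ_EFin _ _ (cont_comp_circ (p := p) (X := X) cf)) -EFinM lee_fin; apply.
move=> z /=; rewrite subr0 normc_def lecR realify_line ap bX => zz.
apply: dO; rewrite -(sqr_sqrtr (_ : 0 <= complex.Re z ^+ 2 + complex.Im z ^+ 2)).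
  by rewrite expr_le1// sqrtr_ge0.
by rewrite addr_ge0// sqr_ge0.
Qed.

Lemma circ_submean_psh U v : continuous v ->
  (forall p X, disc_in U p X -> circ_submean v p X) -> psh U (EFin \o v).
Proof.
move=> cv sv; split.
- by move=> x _; rewrite /= ltry.
- move=> x _ a; rewrite /= lte_fin => va.
  apply: cvg_within; have := cv x => /cvgr_lt /(_ _ va).
  by apply: filterS => y; rewrite lte_fin.
- move=> a b c r r0 sU.
  set p := realify (a + c *: b); set X := r *: realify b.
  have E z : realify (a + (c + r%:C%C * z) *: b)
    = p + complex.Re z *: X + complex.Im z *: rotJ X.
    rewrite scalerDl addrA realify_line -/p /X rotJZ; case: z => x y.
    by rewrite !scalerA /= !mul0r subr0 addr0 [r * x]mulrC [r * y]mulrC.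
  have dU : disc_in U p X.
    move=> x y xy; have := E (x +i* y)%C; rewrite /= => <-; apply: sU => /=.
    rewrite addrAC subrr add0r normrM !normc_def/= expr0n/= addr0 sqrtr_sqr gtr0_norm//.
    rewrite -rmorphM/= lecR -[leRHS]mulr1 ler_pM2l// -sqrtr1 ler_wsqrtr//.
  have := sv _ _ dU; rewrite /circ_submean /mean -lee_fin EFinM.
  rewrite -(integ_EFin _ _ (cont_comp_circ (p := p) (X := X) cv)) /=.
  have E' t : realify (a + circle_pt c r t *: b) = circ p X t by rewrite E.
  by under [X in _ -> (_ <= _ * X)%E]eq_integral do rewrite E'.
Qed.

(** A convolution is an integral of translates with nonnegative weights. Fubini exchanges it with
    the circular mean, and the inequality for each translate is integrated. *)
Lemma circ_submean_convol (h : R) (k : R -> R) (w : 'rV[R]_(n + n)) f p X :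
  0 < h -> continuous k -> continuous f -> (forall s, 0 <= k s) ->
  (forall s, `|s| <= h -> circ_submean f (p - s *: w) X) ->
  circ_submean (convol h k w f) p X.
Proof.
move=> h0 ck cf k0 sf; rewrite /circ_submean /mean /convol.
have hh : - h <= h by have := h0; lra.
have cF : continuous (fun q : R * R => k q.2 * f (circ p X q.1 - q.2 *: w)).
  move=> q; apply: (@continuous_comp _ _ _ (fun q : R * R => (circ p X q.1, q.2))
    (fun q : 'rV[R]_(n + n) * R => k q.2 * f (q.1 - q.2 *: w))); last first.
    exact: cont_convol_integrand.
  apply: (@cvg_pair _ _ _ _ (nbhs (circ p X q.1)) (nbhs q.2)); last exact: cvg_snd.
  apply: (@continuous_comp _ _ _ fst (circ p X)); first exact: cvg_fst.
  exact: cont_circ.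
rewrite (@integ_fubini _ (fun t s => k s * f (circ p X t - s *: w))) ?pi2_ge0//.
rewrite -integZ; last first.
  exact: (@cont_integ _ _ (fun s t => k s * f (circ p X t - s *: w)) _ _ pi2_ge0
    (cont_pair_swap (F := fun t s => k s * f (circ p X t - s *: w)) cF)).
apply: le_integ; first exact: cont_integrand.
  move=> s; apply: cvgM; first exact: cvg_cst.
  exact: (@cont_integ _ _ (fun s t => k s * f (circ p X t - s *: w)) _ _ pi2_ge0
    (cont_pair_swap (F := fun t s => k s * f (circ p X t - s *: w)) cF)).
move=> s; rewrite -ler_norml => /sf; rewrite /circ_submean /mean => fs.
have E t : circ (p - s *: w) X t = circ p X t - s *: w.
  by rewrite /circ (addrAC p) (addrAC (p + _)).
rewrite (_ : (fun t => k s * _)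
  = (fun t => k s * f (circ (p - s *: w) X t))); last first.
  by apply/funext => t; rewrite E.
rewrite integZ; last exact: cont_comp_circ.
by rewrite mulrCA ler_wpM2l.
Qed.

End realify.

(** * From small circles to all discs *)

Section local_global.
Variables (R : realType) (n : nat).
Implicit Types (p c X : 'rV[R]_(n + n)) (f : 'rV[R]_(n + n) -> R).

Lemma circ_period p X t : circ p X (t + 2 * pi) = circ p X t.
Proof. by rewrite /circ mulr_natl cosD2pi sinD2pi. Qed.

(** For an antiderivative P of the periodic [g], the difference P(t + 2 pi) - P(t) has derivative 0,
    hence equals its value at t = 0. *)
Lemma mean_shift (g : R -> R) (al : R) : continuous g ->
  (forall t, g (t + 2 * pi) = g t) -> mean (fun t => g (t + al)) = mean g.
Proof.
move=> cg gp; have dP (t : R) : is_derive t 1 (prim g) (g t) := is_derive_prim t cg.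
have ds (b : R) (t : R) : is_derive t 1 (fun t => prim g (t + b)) (g (t + b)).
  have dg : is_derive t 1 (fun r : R => r + b) 1.
    by apply: (is_derive_eq (is_deriveD (is_derive_id t 1) (is_derive_cst b t 1)));
      rewrite addr0.
  have : is_derive t 1 (prim g \o (fun r : R => r + b)) (g (t + b) * 1).
    exact: is_derive1_comp.
  by rewrite mulr1.
have cgs b : continuous (fun t => g (t + b)).
  move=> t; apply: (@continuous_comp _ _ _ (fun t => t + b) g); last exact: cg.
  by apply: cvgD; [exact: cvg_id|exact: cvg_cst].
have E b : integ 0 (2 * pi) (fun t => g (t + b)) = prim g (b + 2 * pi) - prim g (b + 0).
  by rewrite (FTC2 (@pi2_ge0 R) (cgs b) (ds b)) addrC [0 + b]addrC addrC [_ + b]addrC.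
congr (_ * _); rewrite E.
have -> : integ 0 (2 * pi) g = prim g (0 + 2 * pi) - prim g (0 + 0).
  by rewrite -E; apply: eq_integ => t _; rewrite addr0.
have dD (t : R) : is_derive t 1
    ((fun t => prim g (t + 2 * pi)) - (fun t => prim g (t + 0))) 0.
  apply: (is_derive_eq (is_deriveB (ds (2 * pi) t) (ds 0 t))).
  by rewrite gp addr0 subrr.
exact: (is_derive_0_is_cst al 0 dD).
Qed.

Let sqr_le1 (a : R) : a ^+ 2 <= 1 -> -1 <= a <= 1.
Proof. by move=> h; rewrite -ler_norml -(@expr_le1 _ 2)// real_normK ?num_real. Qed.

Lemma polar (a b : R) : a ^+ 2 + b ^+ 2 = 1 ->
  exists al, a = cos al /\ b = sin al.
Proof.
move=> ab1; have a1 : -1 <= a <= 1.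
  by apply: sqr_le1; rewrite -ab1 lerDl sqr_ge0.
have sb : Num.sqrt (1 - a ^+ 2) = `|b|.
  by rewrite -ab1 addrAC subrr add0r sqrtr_sqr.
have [b0|b0] := leP 0 b.
  by exists (acos a); rewrite acosK// sin_acos// sb ger0_norm.
by exists (- acos a); rewrite cosN sinN acosK// sin_acos// sb ltr0_norm ?opprK.
Qed.

Lemma circ_rot p X (a b t : R) : circ p (a *: X + b *: rotJ X) t =
  p + (a * cos t - b * sin t) *: X + (b * cos t + a * sin t) *: rotJ X.
Proof.
rewrite /circ rotJD !rotJZ rotJK; apply/rowP => i.
by move: (rotJ X) => Y; rewrite !mxE; ring.
Qed.

(** Rotating a small circle about the point (a, b) by the angle [s] gives a circle of the same size
    about the rotated point. This is what transfers the local inequality from f to its rotational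
    average. *)
Lemma circ_circ p X (a b r s t : R) :
  circ (circ p (a *: X + b *: rotJ X) s) (r *: (cos s *: X + sin s *: rotJ X)) t =
  circ p ((a + r * cos t) *: X + (b + r * sin t) *: rotJ X) s.
Proof.
rewrite !circ_rot /circ !rotJZ rotJD !rotJZ rotJK; apply/rowP => i.
by move: (rotJ X) => Y; rewrite !mxE; ring.
Qed.

Lemma unit_disc_compact : compact [set q : R * R | q.1 ^+ 2 + q.2 ^+ 2 <= 1].
Proof.
apply: (@subclosed_compact _ _ (`[-1, 1] `*` `[-1, 1] : set (R * R))).
- apply: (@closed_comp _ _ (fun q : R * R => q.1 ^+ 2 + q.2 ^+ 2) [set x | x <= 1]).
    move=> q _; apply: cvgD; rewrite expr2.
      by apply: cvgM; exact: cvg_fst.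
    by apply: cvgM; exact: cvg_snd.
  exact: closed_le.
- by apply: compact_setX; exact: segment_compact.
- move=> [a b] /= ab; rewrite !in_itv/=.
  by have := sqr_ge0 a; have := sqr_ge0 b; split; apply: sqr_le1; lra.
Qed.


Lemma cont_family f p X : continuous f ->
  continuous (fun r : (R * R) * R => f (circ p (r.1.1 *: X + r.1.2 *: rotJ X) r.2)).
Proof.
move=> cf; pose g (r : (R * R) * R) := p + (r.1.1 * cos r.2 - r.1.2 * sin r.2) *: X +
  (r.1.2 * cos r.2 + r.1.1 * sin r.2) *: rotJ X.
rewrite (_ : (fun _ => _) = f \o g); last first.
  by apply/funext => r; rewrite /= circ_rot.
move=> r; apply: continuous_comp; last exact: cf.
have c11 : {for r, continuous (fun r : (R * R) * R => r.1.1)}.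
  by apply: (@continuous_comp _ _ _ fst fst); exact: cvg_fst.
have c12 : {for r, continuous (fun r : (R * R) * R => r.1.2)}.
  by apply: (@continuous_comp _ _ _ fst snd); [exact: cvg_fst|exact: cvg_snd].
have cc : {for r, continuous (fun r : (R * R) * R => cos r.2)}.
  by apply: (@continuous_comp _ _ _ snd cos); [exact: cvg_snd|exact: continuous_cos].
have cs : {for r, continuous (fun r : (R * R) * R => sin r.2)}.
  by apply: (@continuous_comp _ _ _ snd sin); [exact: cvg_snd|exact: continuous_sin].
apply: cvgD; first (apply: cvgD; first exact: cvg_cst);
  apply: cvgZr_tmp; [apply: cvgB|apply: cvgD]; exact: cvgM.
Qed.

(* The average G of f over the rotations of the disc is radial and still
   satisfies the local submean inequality, so that G + e |.|^2 attains its
   maximum over the closed unit disc on the boundary circle only; there G is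
   the mean of f, while G is f p at the centre. *)
Lemma circ_submean_local (A : set 'rV[R]_(n + n)) (sigma : R) f p X :
  0 < sigma -> continuous f ->
  (forall c Y, A c -> `|Y| <= sigma -> circ_submean f c Y) ->
  disc_in A p X -> circ_submean f p X.
Proof.
move=> s0 cf loc dA; apply/ler_addgt0Pr => e e0.
pose Z (q : R * R) := q.1 *: X + q.2 *: rotJ X.
pose G (q : R * R) := mean (fun t => f (circ p (Z q) t)).
pose N (q : R * R) := q.1 ^+ 2 + q.2 ^+ 2.
have cfam := @cont_family f p X cf.
have cG : continuous G.
  move=> q; apply: cvgM; first exact: cvg_cst.
  exact: (@cont_integ _ _ (fun q t => f (circ p (Z q) t)) _ _ (@pi2_ge0 R) cfam q).
have cN : continuous N.
  by move=> q; apply: cvgD; rewrite expr2; apply: cvgM; by [exact: cvg_fst|exact: cvg_snd].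
have cg : continuous (fun q => G q + e * N q).
  by move=> q; apply: cvgD; [exact: cG|apply: cvgM; [exact: cvg_cst|exact: cN]].
have [] := @compact_EVT_max _ _ (fun q => G q + e * N q)
    [set q : R * R | N q <= 1] _ unit_disc_compact.
- by exists (0, 0); rewrite /N /= expr0n /= addr0 ler01.
- exact: continuous_subspaceT.
move=> [a b]; rewrite inE /= => ab1 maxG.
have G0 : G (0, 0) = f p.
  rewrite /G /Z /= !scale0r addr0 -[RHS](@mean_cst R); congr mean.
  have J0 : rotJ (0 : 'rV[R]_(n + n)) = 0
    by rewrite -[0 in LHS](scale0r (0 : 'rV[R]_(n + n))) rotJZ scale0r.
  by apply/funext => t; rewrite /circ J0 !scaler0 !addr0.
have GN : N (a, b) = 1.
  apply/eqP; rewrite eq_le ab1 leNgt; apply/negP => ab2.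
  (* With r <= 1 one has N(Q t) <= N + 2r + r^2 <= N + 3r, so the second bound keeps the circle in
     the unit disc. The third makes the corresponding circle for f small enough for [loc], as |cos s
     X + sin s JX| <= 2 |X|. *)
  pose r := Num.min 1 (Num.min ((1 - N (a, b)) / 5) (sigma / (2 * `|X| + 1))).
  have X0 : 0 < 2 * `|X| + 1 by rewrite ltr_pwDr// mulr_ge0.
  have r0 : 0 < r by rewrite !lt_min ltr01 !divr_gt0// subr_gt0.
  have r1 : r <= 1 by rewrite ge_min lexx.
  have r2 : r <= (1 - N (a, b)) / 5 by rewrite !ge_min lexx orbT.
  have r3 : r <= sigma / (2 * `|X| + 1) by rewrite !ge_min lexx !orbT.
  pose Q t : R * R := (a + r * cos t, b + r * sin t).
  have NQ t : N (Q t) = N (a, b) + 2 * r * (a * cos t + b * sin t) + r ^+ 2.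
    rewrite /N /=; have := cos2Dsin2 t; move: (cos t) (sin t) => x y xy.
    transitivity (a ^+ 2 + b ^+ 2 + 2 * r * (a * x + b * y) + r ^+ 2 * (x ^+ 2
      + y ^+ 2)).
      by ring.
    by rewrite xy mulr1.
  have NQ1 t : N (Q t) <= 1.
    have ab_le1 : a ^+ 2 + b ^+ 2 <= 1 by [].
    rewrite NQ; have := cos2Dsin2 t.
    move: (cos t) (sin t) (N (a, b)) r2 => x y M r2 xy.
    have ax : a * x + b * y <= 1.
      by have := sqr_ge0 (a - x); have := sqr_ge0 (b - y); lra.
    have rs : r * (a * x + b * y) <= r * 1 by rewrite ler_wpM2l// ltW.
    have rr : r * r <= r * 1 by rewrite ler_wpM2l// ltW.
    by lra.
  have cQ : continuous Q.
    move=> t; apply: (@cvg_pair _ _ _ _ (nbhs (a + r * cos t)) (nbhs (b + r * sin t)));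
      (apply: cvgD; first exact: cvg_cst); (apply: cvgM; first exact: cvg_cst).
      exact: continuous_cos.
    exact: continuous_sin.
  have cGQ : continuous (fun t => G (Q t)).
    by move=> t; apply: (@continuous_comp _ _ _ Q G); [exact: cQ|exact: cG].
  have step1 : G (a, b) <= mean (fun t => G (Q t)).
    have cF : continuous (fun q : R * R => f (circ p (Z (Q q.1)) q.2)).
      move=> q; apply: (@continuous_comp _ _ _ (fun q : R * R => (Q q.1, q.2))
        (fun r : (R * R) * R => f (circ p (r.1.1 *: X + r.1.2 *: rotJ X) r.2)));
        last exact: cfam.
      apply: (@cvg_pair _ _ _ _ (nbhs (Q q.1)) (nbhs q.2)); last exact: cvg_snd.
      by apply: (@continuous_comp _ _ _ fst Q); [exact: cvg_fst|exact: cQ].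
    (* Exchanging the two means leaves, for each rotation angle s, a submean inequality of f on one
       small circle. *)
    have -> : mean (fun t => G (Q t)) =
        mean (fun s => mean (fun t => f (circ p (Z (Q t)) s))).
      rewrite /mean /G /mean.
      have c1 := @cont_integ _ _ (fun t s => f (circ p (Z (Q t)) s)) _ _ (@pi2_ge0 R) cF.
      have c2 := @cont_integ _ _ (fun s t => f (circ p (Z (Q t)) s)) _ _ (@pi2_ge0 R)
        (cont_pair_swap (F := fun t s => f (circ p (Z (Q t)) s)) cF).
      apply: (f_equal (fun z => (2 * pi)^-1 * z)).
      apply: (etrans (integZ 0 (2 * pi) (2 * pi)^-1 c1)).
      apply: etrans (esym (integZ 0 (2 * pi) (2 * pi)^-1 c2)).
      apply: (f_equal (fun z => (2 * pi)^-1 * z)).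
      exact: (@integ_fubini _ (fun t s => f (circ p (Z (Q t)) s)) _ _ _ _
        (@pi2_ge0 R) (@pi2_ge0 R) cF).
    rewrite /G; apply: le_mean; first exact: cont_comp_circ.
      move=> s; apply: cvgM; first exact: cvg_cst.
      exact: (@cont_integ _ _ (fun s t => f (circ p (Z (Q t)) s)) _ _ (@pi2_ge0 R)
        (cont_pair_swap (F := fun t s => f (circ p (Z (Q t)) s)) cF)).
    move=> s; pose Y := r *: (cos s *: X + sin s *: rotJ X).
    have : circ_submean f (circ p (Z (a, b)) s) Y.
      apply: loc.
        rewrite /Z circ_rot; apply: dA.
        apply: le_trans ab1; rewrite /N /=.
        have := cos2Dsin2 s; move: (cos s) (sin s) => x y xy.
        have -> : (a * x - b * y) ^+ 2 + (b * x + a * y) ^+ 2 =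
          (a ^+ 2 + b ^+ 2) * (x ^+ 2 + y ^+ 2) by ring.
        by rewrite xy mulr1.
      rewrite /Y normrZ gtr0_norm// -(ler_pM2r X0) in r3 *.
      have h1 : `|cos s *: X + sin s *: rotJ X| <= 2 * `|X|.
        rewrite (le_trans (ler_normD _ _))// !normrZ mulr_natl mulr2n lerD//.
          by rewrite ler_piMl// cos_max.
        rewrite -[leRHS]mul1r ler_pM// ?sin_max//; exact: norm_rotJ.
      move: r3; rewrite mulfVK ?gt_eqF// => r3; apply: le_trans r3.
      by rewrite ler_wpM2l ?(ltW r0)// (le_trans h1)// lerDl.
    rewrite /circ_submean (_ : (fun t => f (circ (circ _ _ _) _ t)) =
      (fun t => f (circ p (Z (Q t)) s)))//.
    by apply/funext => t; rewrite /Y /Z circ_circ.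
  (* Maximality at (a, b) rewritten as a bound on G alone. Under the mean over t the cosine and sine
     terms vanish, which leaves the strict loss e r^2 and contradicts [step1]. *)
  have step2 t : G (Q t)
    <= G (a, b) - e * r ^+ 2 - 2 * r * e * a * cos t - 2 * r * e * b * sin t.
    have /(_ _)/= := maxG (Q t); rewrite inE => /(_ (NQ1 t)); rewrite NQ.
    move: (G (Q t)) (G (a, b)) (N (a, b)) (cos t) (sin t) => g1 g2 M x y h.
    rewrite -(lerD2r (e * (M + 2 * r * (a * x + b * y) + r ^+ 2))) (le_trans h)//.
    by rewrite le_eqVlt; apply/orP; left; apply/eqP; ring.
  have : mean (fun t => G (Q t)) <= G (a, b) - e * r ^+ 2.
    pose c0 := G (a, b) - e * r ^+ 2.
    have ck (k : R) (u : R -> R) : continuous u -> continuous (fun t => k * u t).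
      by move=> cu t; apply: cvgM; [exact: cvg_cst|exact: cu].
    have cc := ck (- (2 * r * e * a)) _ (@continuous_cos R).
    have cs := ck (- (2 * r * e * b)) _ (@continuous_sin R).
    have c0c : continuous (fun t => - (2 * r * e * a) * cos t
      + - (2 * r * e * b) * sin t).
      by move=> t; apply: cvgD; [exact: cc|exact: cs].
    have ccst : continuous (fun _ : R => c0) by move=> ?; exact: cvg_cst.
    apply: (@le_trans _ _ (mean (fun t => c0 +
      (- (2 * r * e * a) * cos t + - (2 * r * e * b) * sin t)))).
      apply: le_mean; [exact: cGQ| |].
        by move=> t; apply: cvgD; [exact: cvg_cst|exact: c0c].
      move=> t; apply: le_trans (step2 t) _; rewrite /c0.
      move: (G (a, b)) (cos t) (sin t) => g2 x y.
      by rewrite le_eqVlt; apply/orP; left; apply/eqP; ring.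
    rewrite (meanD ccst c0c) mean_cst (meanD cc cs).
    rewrite (meanZ _ (@continuous_cos R)) (meanZ _ (@continuous_sin R)).
    by rewrite mean_cos mean_sin !mulr0 !addr0.
  move=> h2; have := le_trans step1 h2; apply/negP; rewrite -ltNge.
  by rewrite gtrDl oppr_lt0 mulr_gt0// exprn_gt0.
have G1 : G (a, b) = mean (fun t => f (circ p X t)).
  have [al [/= ea eb]] := polar GN.
  rewrite -[RHS](mean_shift al (cont_comp_circ cf)).
    rewrite /G; congr mean; apply/funext => t;
      rewrite /Z circ_rot /circ /= ea eb cosD sinD.
    by congr (f (_ + _ *: _ + _ *: _)); ring.
  by move=> t; rewrite circ_period.
(* The added term is 0 at the centre and e on the boundary circle, so comparing the two points gives
   the claim up to e. *)
have := maxG (0, 0); rewrite inE G0 G1 GN {1 2}/N /= expr0n /= addr0 => /(_ ler01).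
by rewrite mulr0 addr0 mulr1.
Qed.

End local_global.

(** * Finite families and compactness *)

Section general.
Variable R : realType.

Lemma seq_common_bound (I : eqType) (js : seq I) (P : I -> R -> Prop) :
  (forall j a b, 0 < b <= a -> P j a -> P j b) ->
  (forall j, j \in js -> exists2 a, 0 < a & P j a) ->
  exists2 a, 0 < a & forall j, j \in js -> P j a.
Proof.
move=> Pmono; elim: js => [_|i js ih h]; first by exists 1.
have [j jjs|a a0 ha] := ih; first by apply: h; rewrite inE jjs orbT.
have [b b0 hb] := h i (mem_head _ _).
have m0 : 0 < Num.min a b by rewrite lt_min a0.
exists (Num.min a b) => // j; rewrite inE => /predU1P[->|/ha].
  by apply: Pmono hb; rewrite m0 ge_min lexx orbT.
by apply: Pmono; rewrite m0 ge_min lexx.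
Qed.

Lemma max_family (T : topologicalType) (I : eqType) (js : seq I)
    (F : I -> T -> R) : js != [::] -> (forall j, continuous (F j)) ->
  exists f : T -> R, [/\ continuous f, forall j, j \in js -> forall z, F j z <= f z
    & forall z, exists2 j, j \in js & f z = F j z].
Proof.
move=> + cF; elim: js => // i [_ _|j js /(_ isT)[f [cf fge fex]] _].
  exists (F i); split=> [//|j|z]; last by exists i; rewrite ?mem_head.
  by rewrite inE => /eqP ->.
exists (F i \max f); split.
- by move=> z; apply: continuous_max; [exact: cF|exact: cf].
- by move=> k; rewrite inE => /predU1P[->|/fge h] z; rewrite le_max ?lexx// h orbT.
- move=> z; rewrite /=; have [fi|fi] := leP (f z) (F i z).
    by exists i; rewrite ?mem_head.
  by have [k kjs ->] := fex z; exists k => //; rewrite inE kjs orbT.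
Qed.

(** Only [z] is confined to [K]: [y] may leave it, as translates and mollifications of points of the
    closure do. *)
Lemma compact_unif_cont (V : normedModType R) (K : set V) (f : V -> R) (e : R) :
  compact K -> continuous f -> 0 < e ->
  exists2 tau, 0 < tau & forall z y, K z -> `|y - z| <= tau -> `|f y - f z| <= e.
Proof.
move=> cK cf e0.
have cF : continuous (fun p : V * V => f (p.2 + p.1)).
  move=> p; apply: (@continuous_comp _ _ _ (fun p : V * V => p.2 + p.1) f);
    last exact: cf.
  by apply: cvgD; [exact: cvg_snd|exact: cvg_fst].
have := @cont_near R V K V (fun y z => f (z + y)) 0 e cK cF e0.
move=> /nbhs_norm0P[d /= d0 hd]; exists (d / 2); first by rewrite divr_gt0.
move=> z y Kz yz; have yd : `|y - z| < d.
  by rewrite (le_lt_trans yz)// ltr_pdivrMr// ltr_pMr// ltr1n.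
have /= := hd (y - z) yd z Kz.
by rewrite addr0 [z + _]addrC subrK distrC => /ltW.
Qed.

Lemma compact_thicken (V : normedModType R) (K O : set V) :
  compact K -> open O -> K `<=` O ->
  exists2 tau, 0 < tau & forall z y, K z -> `|y - z| <= tau -> O y.
Proof.
move=> /compact_near_coveringP cK oO KO.
have := cK V (nbhs 0) (fun y z => O (z + y)).
have H : forall z, K z -> \forall z' \near z & y \near (0 : V), O (z' + y).
  move=> z Kz.
  have : \forall x \near (z + 0 : V), O x
    by rewrite addr0; apply: open_nbhs_nbhs; split=> //; exact: KO.
  exact: (@cvgD _ _ _ (nbhs (z, 0 : V)) _ fst snd z 0
    (@cvg_fst _ _ _ _ _) (@cvg_snd _ _ _ _ _)).
move=> /(_ _ H) /nbhs_norm0P[d /= d0 hd]; exists (d / 2); first by rewrite divr_gt0.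
move=> z y Kz yz; have yd : `|y - z| < d.
  by rewrite (le_lt_trans yz)// ltr_pdivrMr// ltr_pMr// ltr1n.
by have := hd (y - z) yd z Kz; rewrite /= [z + _]addrC subrK.
Qed.

End general.

(** * Euclidean squares and inner products against the sup norm *)

Section euclid.
Variables (R : realType) (m : nat).
Implicit Types x y z w : 'rV[R]_m.

Definition dotp x z : R := \sum_(i < m) z 0 i * x 0 i.
Definition sq z : R := \sum_(i < m) z 0 i ^+ 2.

Lemma sq_ge0 z : 0 <= sq z.
Proof. by apply: sumr_ge0 => i _; exact: sqr_ge0. Qed.

Lemma sqB z x : sq (z - x) = sq z - 2 * dotp x z + sq x.
Proof.
rewrite /sq /dotp mulr_sumr -sumrB -big_split; apply: eq_bigr => i _ /=.
by rewrite !mxE; ring.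
Qed.

Lemma sqD_le y z : sq (y + z) <= 2 * sq y + 2 * sq z.
Proof.
rewrite /sq !mulr_sumr -big_split; apply: ler_sum => i _ /=; rewrite !mxE.
by have := sqr_ge0 (y 0 i - z 0 i); lra.
Qed.

Lemma dotpD x y z : dotp x (y + z) = dotp x y + dotp x z.
Proof. by rewrite /dotp -big_split; apply: eq_bigr => i _; rewrite mxE mulrDl. Qed.

Lemma dotpZ x (a : R) z : dotp x (a *: z) = a * dotp x z.
Proof. by rewrite /dotp mulr_sumr; apply: eq_bigr => i _; rewrite mxE mulrA. Qed.

Lemma cont_sum (T : topologicalType) (I : Type) (r : seq I) (F : I -> T -> R) :
  (forall i, continuous (F i)) -> continuous (fun t => \sum_(i <- r) F i t).
Proof.
move=> cF; elim: r => [|i r ih] t.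
  by under eq_fun do rewrite big_nil; exact: cvg_cst.
by under eq_fun do rewrite big_cons; apply: cvgD; [exact: cF|exact: ih].
Qed.

Lemma cont_sqB x : continuous (fun z => sq (z - x)).
Proof.
rewrite /sq; apply: cont_sum => i z.
have h : {for z, continuous (fun z => (z - x) 0 i)}.
  apply: (@continuous_comp _ _ _ (fun z => z - x) (fun z => z 0 i));
    last exact: coord_continuous.
  by apply: (@cvgB _ _ _ (nbhs z)); [exact: cvg_id|exact: cvg_cst].
exact: (cvgM h h).
Qed.

Lemma cont_dotp x : continuous (dotp x).
Proof.
apply: cont_sum => i z; apply: (@cvgM _ _ (nbhs z)); last exact: cvg_cst.
exact: coord_continuous.
Qed.

Lemma norm_le_sq z (e : R) : 0 <= e -> sq z <= e ^+ 2 -> `|z| <= e.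
Proof.
move=> e0 ze; apply/rV_norm_leP => // i.
rewrite -(@ler_pXn2r _ 2)// ?nnegrE// real_normK ?num_real//.
apply: le_trans ze; rewrite /sq (bigD1 i)//= lerDl.
by apply: sumr_ge0 => j _; exact: sqr_ge0.
Qed.

Lemma sq_small (e : R) : 0 < e -> exists2 d, 0 < d & forall z, `|z| <= d -> sq z <= e.
Proof.
move=> e0; have := @cont_sqB 0 0; rewrite /continuous_at subr0.
have -> : sq 0 = 0 by rewrite /sq big1// => i _; rewrite mxE expr0n.
move=> /cvgr_le /(_ _ e0) /nbhs_norm0P[d /= d0 hd].
exists (d / 2); first by rewrite divr_gt0.
move=> z zd; have := hd z; rewrite subr0; apply.
by rewrite /= (le_lt_trans zd)// ltr_pdivrMr// ltr_pMr// ltr1n.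
Qed.

Lemma eball_thick (c x : 'rV[R]_m) (r : R) : eball c r x ->
  exists2 d, 0 < d & forall y, `|y - x| <= d -> eball c r y.
Proof.
move=> cx; have ce : continuous (fun y : 'rV[R]_m => enorm (y - c)).
  move=> y; apply: (@continuous_comp _ _ _ (fun y => sq (y - c)) Num.sqrt).
    exact: cont_sqB.
  exact: sqrt_continuous.
have : nbhs x (eball c r) by have := ce x; move/cvgr_lt => /(_ _ cx).
move=> /nbhs_normP[d /= d0 hd]; exists (d / 2); first by rewrite divr_gt0.
move=> y yd; apply: hd; rewrite /= distrC (le_lt_trans yd)//.
by rewrite ltr_pdivrMr// ltr_pMr// ltr1n.
Qed.

Lemma open_thick (O : set 'rV[R]_m) x : open O -> O x ->
  exists2 d, 0 < d & forall y, `|y - x| <= d -> O y.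
Proof.
move=> oO Ox; have [|d d0 hd] := compact_thicken (@compact_set1 _ x) oO.
  by move=> _ ->.
by exists d => // y; exact: hd.
Qed.

End euclid.

(** * Inward translation at a C^0 boundary *)

Section shift.
Variables (R : realType) (m : nat) (Omega : set 'rV[R]_m).
Hypothesis Omega_open : open Omega.
Hypothesis Omega_C0 : C0_boundary Omega.

(** In the local coordinates a point of the closure satisfies y_m >= phi(y'), with equality on the
    boundary. Moving it by t > 0 in the direction y_m keeps y' and makes the inequality strict; [d]
    is small enough for the point and its translate to stay in the ball where the graph describes
    Omega. *)
Lemma inward_shift_sup x : closure Omega x ->
  exists d w, 0 < d /\ forall z t, closure Omega z -> `|z - x| <= d ->
    0 < t <= d -> Omega (z + t *: w).
Proof.
move=> clx; have [Ox|nOx] := pselect (Omega x).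
  have [d d0 hd] := open_thick Omega_open Ox.
  by exists d, 0; split=> // z t _ zd _; rewrite scaler0 addr0; exact: hd.
have bx : bdry Omega x by split=> //; rewrite (interior_id _).1.
have [bs [bs1 [U [_ bU Ub]] bs2]] := Omega_C0.
have [b bbs xb] := Ub _ (bU _ bx).
have [_ b0] := bs1 _ bbs.
have [l [a [Q [phi /= [_ QQ _ E1 E2]]]]] := bs2 _ bbs.
have x4 : eball b.1 (4 * b.2) x.
  by apply: lt_le_trans xb _; rewrite ler_peMl ?(ltW b0)// ler1n.
have [e e0 he] := eball_thick x4.
(* The unit vector of the direction y_m, carried back to the original coordinates. *)
pose w : 'rV[R]_m := delta_mx 0 l *m Q^T.
have wQ : w *m Q = delta_mx 0 l by rewrite -mulmxA (mulmx1C QQ) mulmx1.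
have w1 : 0 < `|w| + 1 by rewrite ltr_pwDr.
pose d := Num.min (e / 2) (e / 2 / (`|w| + 1)).
have d0 : 0 < d by rewrite lt_min !divr_gt0.
have de : d <= e / 2 by rewrite ge_min lexx.
have dw : d * (`|w| + 1) <= e / 2 by rewrite -ler_pdivlMr// ge_min lexx orbT.
exists d, w; split=> // z t clz zx /andP[t0 td].
have zb : eball b.1 (4 * b.2) z.
  by apply: he; rewrite (le_trans zx)// (le_trans de)// ler_piMr ?(ltW e0)// invf_le1// ler1n.
have ztb : eball b.1 (4 * b.2) (z + t *: w).
  apply: he; rewrite addrAC (le_trans (ler_normD _ _))// [leRHS]splitr.
  rewrite lerD ?(le_trans zx)// normrZ gtr0_norm// (le_trans _ dw)//.
  by rewrite ler_pM ?(ltW t0)// lerDl.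
have yt : euclidean_coord a Q (z + t *: w) = euclidean_coord a Q z + t *: delta_mx 0 l.
  by rewrite /euclidean_coord addrAC mulmxDl -scalemxAl wQ.
have yl : col' l (euclidean_coord a Q (z + t *: w)) = col' l (euclidean_coord a Q z).
  rewrite yt; apply/rowP => i; rewrite !mxE eq_sym (negbTE (neq_lift l i)) andbF mulr0 addr0.
  by [].
have phiz : phi (col' l (euclidean_coord a Q z)) <= euclidean_coord a Q z 0 l.
  have [Oz|nOz] := pselect (Omega z).
    have : (Omega `&` eball b.1 (4 * b.2)) z by [].
    by rewrite E1 => -[/= /ltW].
  have : (bdry Omega `&` eball b.1 (4 * b.2)) z.
    by split=> //; split=> //; rewrite (interior_id _).1.
  by rewrite E2 => -[/= ->].
have : ([set x0 | phi (col' l (euclidean_coord a Q x0)) < euclidean_coord a Q x0 0 l]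
    `&` eball b.1 (4 * b.2)) (z + t *: w).
  split=> //=; rewrite yl yt (le_lt_trans phiz)// [ltRHS]mxE ltrDl.
  by rewrite !mxE !eqxx mulr1.
by rewrite -E1 => -[].
Qed.

Lemma inward_shift x : closure Omega x ->
  exists (rho tau : R) w, [/\ 0 < rho, rho <= 1, 0 < tau &
    forall z t, closure Omega z -> sq (z - x) <= 8 * rho ^+ 2 ->
      0 < t <= tau -> Omega (z + t *: w)].
Proof.
move=> clx; have [d [w [d0 h]]] := inward_shift_sup clx.
(* Then 8 rho^2 <= 8 d^2 / 9 <= d^2, so the Euclidean bound implies the sup norm bound [d]. The cap
   1 will bound the terms added in the gluing. *)
pose rho := Num.min 1 (d / 3).
have r0 : 0 < rho by rewrite lt_min ltr01 divr_gt0.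
have r1 : rho <= 1 by rewrite ge_min lexx.
have r3 : rho <= d / 3 by rewrite ge_min lexx orbT.
exists rho, d, w; split=> // z t clz zx td; apply: h => //.
apply: norm_le_sq; first exact: ltW.
apply: le_trans zx _; have : rho ^+ 2 <= (d / 3) ^+ 2 
  by apply: lerXn2r => //; rewrite nnegrE; [exact: ltW|rewrite divr_ge0// ltW].
by have := sqr_ge0 d; lra.
Qed.

End shift.

(** * Regularization and gluing *)

Section psh_tools.
Variables (R : realType) (n : nat).
Implicit Types (p c X x a : 'rV[R]_(n + n)) (f u : 'rV[R]_(n + n) -> R).

Lemma circ_submean_mollify (h : R) (k : nat -> R -> R) (l : seq 'I_(n + n)) f p X :
  0 < h -> (forall i (s : R), is_derive s 1 (k i) (k i.+1 s)) ->
  (forall s, 0 <= k 0%N s) -> continuous f ->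
  (forall q, `|q - p| <= (size l)%:R * h -> circ_submean f q X) ->
  circ_submean (mollify h k (fun=> 0%N) l f) p X.
Proof.
move=> h0 dk k0 cf; elim: l p => [|i l ih] p sf /=.
  by apply: sf; rewrite subrr normr0 mul0r.
apply: circ_submean_convol => //; [exact: cont_kernel dk 0%N|exact: cont_mollify|].
move=> s sh; apply: ih => q ql; apply: sf.
rewrite -(subrK (p - s *: delta_mx 0 i) q) -addrA (le_trans (ler_normD _ _))//.
rewrite /= -[in leRHS]addn1 natrD mulrDl mul1r lerD//.
rewrite addrAC subrr add0r normrN normrZ -[leRHS]mulr1.
by apply: ler_pM => //; exact: norm_delta.
Qed.

Lemma circDl c a X t : circ (c + a) X t = circ c X t + a.
Proof. by rewrite /circ (addrAC c a) (addrAC (c + _) a). Qed.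

Lemma mean_dotp x c X : mean (fun t => dotp x (circ c X t)) = dotp x c.
Proof.
have ck (b : R) (g : R -> R) : continuous g -> continuous (fun t => b * g t).
  by move=> cg t; apply: cvgM; [exact: cvg_cst|exact: cg].
have ccos := ck (dotp x X) _ (@continuous_cos R).
have csin := ck (dotp x (rotJ X)) _ (@continuous_sin R).
have ccst : continuous (fun _ : R => dotp x c) by move=> ?; exact: cvg_cst.
have -> : (fun t => dotp x (circ c X t)) = (fun t => dotp x c +
    (dotp x X * cos t + dotp x (rotJ X) * sin t)).
  by apply/funext => t; rewrite /circ !dotpD !dotpZ; ring.
have cs : continuous (fun t => dotp x X * cos t + dotp x (rotJ X) * sin t).
  by move=> t; apply: cvgD; [exact: ccos|exact: csin].
rewrite (meanD ccst cs) mean_cst (meanD ccos csin).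
rewrite (meanZ _ (@continuous_cos R)) (meanZ _ (@continuous_sin R)).
by rewrite mean_cos mean_sin !mulr0 !addr0.
Qed.

Lemma circ_submean_shift_affine f a x (b d : R) c X : continuous f ->
  circ_submean f (c + a) X ->
  circ_submean (fun z => f (z + a) + (b + d * dotp x z)) c X.
Proof.
move=> cf sf; rewrite /circ_submean.
have cd : continuous (fun t => dotp x (circ c X t)).
  exact: (cont_comp_circ (@cont_dotp _ _ x)).
have cdd : continuous (fun t => d * dotp x (circ c X t)).
  by move=> t; apply: cvgM; [exact: cvg_cst|exact: cd].
have ccst : continuous (fun _ : R => b) by move=> ?; exact: cvg_cst.
have cb : continuous (fun t => b + d * dotp x (circ c X t)).
  by move=> t; apply: cvgD; [exact: ccst|exact: cdd].
have cfa : continuous (fun t => f (circ c X t + a)).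
  have -> : (fun t => f (circ c X t + a)) = (fun t => f (circ (c + a) X t)).
    by apply/funext => t; rewrite circDl.
  exact: cont_comp_circ.
rewrite (meanD cfa cb) (meanD ccst cdd) (meanZ _ cd) mean_dotp mean_cst lerD2r.
have -> : (fun t => f (circ c X t + a)) = (fun t => f (circ (c + a) X t)).
  by apply/funext => t; rewrite circDl.
exact: sf.
Qed.

(** The sup norm is not invariant under the rotations of a complex line; the triangle inequality
    gives the factor 2. *)
Lemma norm_disc X (a b : R) : a ^+ 2 + b ^+ 2 <= 1 ->
  `|a *: X + b *: rotJ X| <= 2 * `|X|.
Proof.
move=> ab; have le1 (y : R) : y ^+ 2 <= 1 -> `|y| <= 1.
  by move=> y1; rewrite -(@expr_le1 _ 2)// real_normK ?num_real.
rewrite (le_trans (ler_normD _ _))// !normrZ mulr_natl mulr2n lerD//.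
  by rewrite ler_piMl// le1// (le_trans _ ab)// lerDl sqr_ge0.
rewrite -[leRHS]mul1r ler_pM//; last exact: norm_rotJ.
by rewrite le1// (le_trans _ ab)// lerDr sqr_ge0.
Qed.

Lemma psh_regularize (K : set 'rV[R]_(n + n)) (sigma eps : R) f : compact K ->
  0 < sigma -> 0 < eps -> continuous f ->
  (forall z c X, K z -> `|c - z| <= sigma -> `|X| <= sigma -> circ_submean f c X) ->
  exists v, [/\ psh_near K (EFin \o v), smooth_near K v &
    forall z, K z -> `|f z - v z| <= eps].
Proof.
move=> cK s0 e0 cf sf.
have [tau tau0 ftau] := compact_unif_cont cK cf e0.
set l := enum 'I_(n + n); pose m : R := (size l)%:R.
have m0 : 0 <= m by [].
(* Half of [sigma] is the width of the neighbourhood of [K], the other half is left for the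
   displacement caused by mollifying. *)
pose s2 := sigma / 2; have s20 : 0 < s2 by rewrite divr_gt0.
pose h := Num.min tau s2 / (m + 1).
have m1 : 0 < m + 1 by rewrite ltr_pwDr.
have h0 : 0 < h by rewrite divr_gt0// lt_min tau0.
have mh : m * h <= Num.min tau s2.
  have -> : Num.min tau s2 = (m + 1) * h by rewrite mulrC /h mulfVK// gt_eqF.
  by rewrite ler_wpM2r ?(ltW h0)// lerDl.
have mht : m * h <= tau by rewrite (le_trans mh)// ge_min lexx.
have mhs : m * h <= s2 by rewrite (le_trans mh)// ge_min lexx orbT.
have [k [dk k_supp k_ge0 k_int]] := smooth_bump h0.
exists (mollify h k (fun=> 0%N) l f); split.
- pose U := \bigcup_(z in K) [set c : 'rV[R]_(n + n) | `|c - z| < s2].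
  exists U; split.
  + apply: bigcup_open => z _.
    apply: (@open_comp _ _ (fun c : 'rV[R]_(n + n) => `|c - z|)
      [set r : R | r < s2]); last exact: open_lt.
    move=> c _; apply: (@continuous_comp _ _ _ (fun c => c - z) (fun y => `|y|));
      last exact: norm_continuous.
    by apply: (@cvgB _ _ _ (nbhs c)); [exact: cvg_id|exact: cvg_cst].
  + by move=> z Kz; exists z; rewrite //= subrr normr0.
  + apply: circ_submean_psh; first exact: cont_mollify.
    (* The hypothesis on [f] covers circles of size at most [sigma] only; mollification keeps this
       bound, and the local-to-global lemma then reaches every disc in [U]. *)
    move=> p X dU; apply: (circ_submean_local s0 _ _ dU); first exact: cont_mollify.
    move=> c Y [z Kz /= cz] Ys.
    apply: circ_submean_mollify => // q qc; apply: (sf z) => //.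
    rewrite -(subrK c q) -addrA (le_trans (ler_normD _ _))//.
    by rewrite [leRHS]splitr lerD// ?(le_trans qc)// ltW.
- exists setT; split=> //; first exact: openT.
  by apply: smooth_mollify => //; [exact: enum_uniq|move=> i; rewrite mem_enum].
- move=> z Kz; rewrite distrC; apply: mollify_close => // y yz.
  by apply: ftau => //; exact: le_trans mht.
Qed.

(** Order of the choices: a finite cover with radii rho_j, then [delta] from [eps], then [eta] small
    against every delta rho_j^2, then one [t] for which all translates stay within [eta] of f, and
    finally [sigma], so that this persists slightly beyond the closure. *)
Lemma psh_glue (Omega : set 'rV[R]_(n + n)) u f (eps : R) : open Omega ->
  C0_boundary Omega -> compact (closure Omega) -> closure Omega !=set0 ->
  psh Omega (EFin \o u) -> continuous f -> (forall z, Omega z -> u z = f z) ->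
  0 < eps ->
  exists g (sigma : R), [/\ continuous g, 0 < sigma,
    forall z, closure Omega z -> `|f z - g z| <= eps &
    forall z c X, closure Omega z -> `|c - z| <= sigma -> `|X| <= sigma ->
      circ_submean g c X].
Proof.
move=> oO C0 cK K0 pu cf uf e0; set K := closure Omega in cK K0 *.
(* [T x] packs rho, tau and w; outside [K] it is the dummy value 0. *)
have /choice[T hT] : forall x, exists T : R * R * 'rV[R]_(n + n), K x ->
    [/\ 0 < T.1.1, T.1.1 <= 1, 0 < T.1.2 &
    forall z t, K z -> sq (z - x) <= 8 * T.1.1 ^+ 2 ->
      0 < t <= T.1.2 -> Omega (z + t *: T.2)].
  move=> x; have [Kx|nKx] := pselect (K x); last by exists (0, 0, 0).
  by have [rho [tau [w [h1 h2 h3 h4]]]] := inward_shift oO C0 Kx; exists (rho, tau, w).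
pose rho x := (T x).1.1; pose tau x := (T x).1.2; pose w x := (T x).2.
pose B x := [set z : 'rV[R]_(n + n) | sq (z - x) < rho x ^+ 2].
have oB x : open (B x).
  rewrite /B.
  apply: (@open_comp _ _ (fun z : 'rV[R]_(n + n) => sq (z - x))
    [set r : R | r < rho x ^+ 2]); last exact: open_lt.
  by move=> z _; exact: cont_sqB.
have sq0 : sq (0 : 'rV[R]_(n + n)) = 0 by rewrite /sq big1// => i _; rewrite mxE expr0n.
have [D' D'K covK] : finite_subset_cover K B K.
  move: (cK); rewrite compact_cover; apply => // z Kz; exists z => //.
  by have [r0 _ _ _] := hT _ Kz; rewrite /B /= subrr sq0 exprn_gt0.
pose js : seq 'rV[R]_(n + n) := finmap.enum_fset D'.
have jsK j : j \in js -> K j by move=> jj; apply/set_mem; exact: D'K.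
have js0 : js != [::].
  have [z Kz] := K0; have [j /= jD _] := covK _ Kz.
  by apply/eqP => js0; have : j \in js by []; rewrite js0.
have [r0 r0_gt0 hr0] : exists2 a : R, 0 < a & forall j, j \in js -> a <= rho j ^+ 2
  /\ a <= 1.
  apply: seq_common_bound => [j a b /andP[_ ba] [h1 h2]|j /jsK /hT[h1 h2 _ _]].
    by split; exact: le_trans ba _.
  exists (rho j ^+ 2); first exact: exprn_gt0.
  by split=> //; rewrite expr_le1//; exact: ltW.
have [j1 /hr0[_ r0_le1]] : exists j, j \in js.
  by have [z Kz] := K0; have [j /= jD _] := covK _ Kz; exists j.
have cont_sq : continuous (@sq R (n + n)).
  have -> : @sq R (n + n) = fun z => sq (z - 0) by apply/funext => z; rewrite subr0.
  exact: cont_sqB.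
have [S S0 hS] : exists2 S : R, 0 <= S & forall z, K z -> sq z <= S.
  have [] := compact_EVT_max K0 cK (continuous_subspaceT cont_sq).
  move=> c _ hc; exists (sq c); first exact: sq_ge0.
  by move=> z Kz; apply: hc; rewrite inE.
have S2 : 0 < 2 + S by rewrite ltr_pwDl.
(* As rho_j <= 1 and |z|^2 <= S, the added term is at most delta (1 + S); one more delta pays for
   [eta]. *)
pose delta := eps / (2 + S); have delta0 : 0 < delta by rewrite divr_gt0.
(* Two translates at the same point differ by less than 2 eta = delta r0 / 2, which is below delta
   rho_j^2 for every j. *)
pose eta := delta * r0 / 4.
have eta0 : 0 < eta by rewrite !mulr_gt0// invr_gt0.
have eta_le : eta <= delta.
  by rewrite /eta -mulrA ler_piMr ?(ltW delta0)//; lra.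
(* Half of [eta] on the closure gives a strict inequality, an open condition that survives
   thickening. *)
have eta20 : 0 < eta / 2 by rewrite divr_gt0.
have [tu tu0 htu] := compact_unif_cont cK cf eta20.
have [t t0 ht] : exists2 t : R, 0 < t & forall j, j \in js ->
    t <= tau j /\ t * (`|w j| + 1) <= tu.
  apply: seq_common_bound => [j a b /andP[_ ba] [h1 h2]|j /jsK /hT[_ _ h1 _]].
    split; first exact: le_trans ba _.
    by apply: le_trans h2; rewrite ler_wpM2r// addr_ge0.
  have w1 : 0 < `|w j| + 1 by rewrite ltr_pwDr.
  exists (Num.min (tau j) (tu / (`|w j| + 1))).
    by rewrite lt_min h1 divr_gt0.
  by rewrite -ler_pdivlMr// !ge_min !lexx orbT.
have cft (j : 'rV[R]_(n + n)) : continuous (fun z : 'rV[R]_(n + n) => f (z + t *: w j)).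
  move=> z; apply: (@continuous_comp _ _ _ (fun z : 'rV[R]_(n + n) => z
    + t *: w j) f); last exact: cf.
  by apply: (@cvgD _ _ _ (nbhs z)); [exact: cvg_id|exact: cvg_cst].
have [s1 s10 hs1] : exists2 s : R, 0 < s & forall j, j \in js ->
    forall z y, K z -> `|y - z| <= s ->
    (sq (y - j) <= 8 * rho j ^+ 2 -> Omega (y + t *: w j)) /\
    `|f (y + t *: w j) - f y| < eta.
  apply: seq_common_bound => [j a b /andP[_ ba] h z y Kz yz|j jjs].
    by apply: (h z) => //; exact: le_trans ba.
  (* The implication required of y, written as a union of open sets so that it extends to a
     neighbourhood of the closure. *)
  pose O1 := [set y : 'rV[R]_(n + n) | 8 * rho j ^+ 2 < sq (y - j)] `|`
             [set y | Omega (y + t *: w j)].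
  pose O2 := [set y : 'rV[R]_(n + n) | `|f (y + t *: w j) - f y| < eta].
  have oO1 : open O1.
    apply: openU.
      apply: (@open_comp _ _ (fun z : 'rV[R]_(n + n) => sq (z - j))
        [set r : R | 8 * rho j ^+ 2 < r]);
        last exact: open_gt.
      by move=> z _; exact: cont_sqB.
    apply: (@open_comp _ _ (fun z : 'rV[R]_(n + n) => z + t *: w j) Omega) => // z _.
    by apply: (@cvgD _ _ _ (nbhs z)); [exact: cvg_id|exact: cvg_cst].
  have oO2 : open O2.
    rewrite /O2.
    apply: (@open_comp _ _ (fun y : 'rV[R]_(n + n) => `|f (y + t *: w j) - f y|)
      [set r : R | r < eta]);
      last exact: open_lt.
    move=> z _; apply: (@continuous_comp _ _ _ (fun y : 'rV[R]_(n + n) => f (y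
      + t *: w j) - f y) (fun y : R => `|y|));
      last exact: norm_continuous.
    by apply: (@cvgB _ _ _ (nbhs z)); [exact: cft|exact: cf].
  have KO : K `<=` O1 `&` O2.
    move=> z Kz; split.
      have [h|h] := leP (sq (z - j)) (8 * rho j ^+ 2); last by left.
      right; have [_ _ _ /(_ z t Kz h)] := hT _ (jsK _ jjs); apply.
      by rewrite t0; have [] := ht _ jjs.
    rewrite /O2 /=; apply: (@le_lt_trans _ _ (eta / 2)); last by lra.
    apply: htu => //; rewrite addrAC subrr add0r normrZ gtr0_norm//.
    by have [_] := ht _ jjs; apply: le_trans; rewrite ler_wpM2l ?(ltW t0)// lerDl.
  have [s s0 hs] := compact_thicken cK (openI oO1 oO2) KO.
  exists s => // z y Kz yz; have [[h|h] h2] := hs _ _ Kz yz; split=> //.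
  by rewrite leNgt h.
have [s2 s20 hs2] : exists2 s : R, 0 < s & forall z y, K z -> `|y - z| <= s ->
    exists2 j, j \in js & sq (y - j) < rho j ^+ 2.
  have oC : open (\bigcup_(j in [set j | j \in js]) B j).
    by apply: bigcup_open => j _; exact: oB.
  have [s s0 hs] := compact_thicken cK oC covK.
  by exists s => // z y Kz yz; have [j jD Bj] := hs _ _ Kz yz; exists j.
have [s3 s30 hs3] := @sq_small R (n + n) r0 r0_gt0.
(* This form shows that the added term is affine; [FE] gives the form used to compare indices. *)
pose F j z := f (z + t *: w j) + ((delta * rho j ^+ 2 - delta * sq j)
  + (2 * delta) * dotp j z).
have FE j z : F j z = f (z + t *: w j) + delta * (rho j ^+ 2 - sq (z - j) + sq z).
  by rewrite /F sqB; ring.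
have cF j : continuous (F j).
  move=> z; apply: (@cvgD _ _ _ (nbhs z)); first exact: cft.
  apply: (@cvgD _ _ _ (nbhs z)); first exact: cvg_cst.
  by apply: (@cvgM _ _ (nbhs z)); [exact: cvg_cst|exact: cont_dotp].
have [g [cg gF gex]] := max_family js0 cF.
(* A third, because a centre within sigma of z is moved by a disc vector of size at most 2 sigma. *)
pose sigma := Num.min s1 (Num.min s2 s3) / 3.
have m0 : 0 < Num.min s1 (Num.min s2 s3) by rewrite !lt_min s10 s20.
have sig0 : 0 < sigma by rewrite divr_gt0.
have sig1 : 3 * sigma <= s1 by rewrite /sigma mulrC mulfVK// ge_min lexx.
have sig2 : 3 * sigma <= s2 by rewrite /sigma mulrC mulfVK// !ge_min lexx orbT.
have sig3 : 3 * sigma <= s3 by rewrite /sigma mulrC mulfVK// !ge_min lexx !orbT.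
exists g, sigma; split=> //.
- move=> z Kz; have zz : `|z - z| <= s1 by rewrite subrr normr0 ltW.
  have zz2 : `|z - z| <= s2 by rewrite subrr normr0 ltW.
  rewrite ler_norml; apply/andP; split.
    have [j jjs ->] := gex z; rewrite FE.
    have [_] := hs1 _ jjs _ _ Kz zz; rewrite ltr_norml => /andP[_ h].
    have rj1 : rho j ^+ 2 <= 1.
      by have [h1 h2 _ _] := hT _ (jsK _ jjs); rewrite expr_le1//; exact: ltW.
    have : delta * (rho j ^+ 2 - sq (z - j) + sq z) <= delta * (1 + S).
      rewrite ler_pM2l//; have := sq_ge0 (z - j); have := hS _ Kz; lra.
    have : delta * (2 + S) = eps by rewrite /delta mulfVK// gt_eqF.
    by move=> h3 h4; lra.
  have [j jjs zj] := hs2 _ _ Kz zz2.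
  have [_] := hs1 _ jjs _ _ Kz zz; rewrite ltr_norml => /andP[h _].
  have := gF _ jjs z; rewrite FE => h1.
  have : 0 <= delta * (rho j ^+ 2 - sq (z - j) + sq z).
    by rewrite mulr_ge0 ?(ltW delta0)//; have := sq_ge0 z; lra.
  have : delta <= eps by rewrite ler_pdivrMr// ler_peMr ?(ltW e0)//; lra.
  by move=> h2 h3; lra.
- move=> z c X Kz cz Xs.
  have cz1 : `|c - z| <= s1 by lra.
  have cz2 : `|c - z| <= s2 by lra.
  have [j jjs gj] := gex c; have [i ijs ci] := hs2 _ _ Kz cz2.
  have [rj0 rj1 _ _] := hT _ (jsK _ jjs); rewrite -/(rho j) in rj0 rj1.
  have [r0j _] := hr0 _ jjs.
  (* The index j realizes the maximum at c, so c is close to the centre j. *)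
  have cj : sq (c - j) <= 2 * rho j ^+ 2.
    have h1 : F i c <= F j c by rewrite -gj; exact: gF.
    have [_] := hs1 _ ijs _ _ Kz cz1; rewrite ltr_norml => /andP[h2 _].
    have [_] := hs1 _ jjs _ _ Kz cz1; rewrite ltr_norml => /andP[_ h3].
    rewrite !FE in h1.
    have h4 : delta * (sq (c - j) - rho j ^+ 2) <= delta * rho j ^+ 2.
      have h5 : 0 <= delta * (rho i ^+ 2 - sq (c - i))
        by rewrite mulr_ge0 ?(ltW delta0)//; lra.
      have h6 : delta * r0 <= delta * rho j ^+ 2 by rewrite ler_pM2l.
      have h7 : 0 < delta * r0 by rewrite mulr_gt0.
      have etaE : eta = delta * r0 / 4 by [].
      by lra.
    by move: h4; rewrite ler_pM2l//; lra.
  have dO : disc_in Omega (c + t *: w j) X.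
    move=> a b ab; have nv := norm_disc X ab.
    pose v := a *: X + b *: rotJ X.
    have vs : `|v| <= 2 * sigma by apply: le_trans nv _; lra.
    have -> : c + t *: w j + a *: X + b *: rotJ X = (c + v) + t *: w j.
      by rewrite /v addrA -!addrA; congr (_ + _); rewrite addrC addrA.
    have cvz : `|c + v - z| <= s1.
      by rewrite addrAC (le_trans (ler_normD _ _))//; lra.
    have [hO _] := hs1 _ jjs z (c + v) Kz cvz.
    (* The bound is 2 (2 rho_j^2) + 2 r0 <= 6 rho_j^2, within the 8 rho_j^2 provided by
       [inward_shift]. *)
    apply: hO; rewrite addrAC; apply: le_trans (sqD_le _ _) _.
    have h1 : `|v| <= s3 by lra.
    have h2 := hs3 v h1; lra.
  have sj : circ_submean (F j) c X.
    apply: circ_submean_shift_affine => //.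
    exact: (psh_circ_submean pu cf uf dO).
  (* [F j] equals g at the centre and lies below g on the circle, so its submean inequality passes
     to g. *)
  rewrite /circ_submean gj; apply: le_trans sj _.
  by apply: le_mean; [exact: cont_comp_circ|exact: cont_comp_circ|move=> s; exact: gF].
Qed.

End psh_tools.

Theorem theorem1 (R : realType) (n : nat) (hn : (0 < n)%N)
    (Omega : set 'rV[R]_(n + n))
    (Omega_open : open Omega) (Omega_connected : connected Omega)
    (Omega_bounded : bounded_set Omega) (Omega_C0 : C0_boundary Omega)
    (u : 'rV[R]_(n + n) -> R)
    (u_psh : psh Omega (EFin \o u))
    (u_cont : {within closure Omega, continuous u})
    (eps : R) (eps_gt0 : 0 < eps) :
  exists v : 'rV[R]_(n + n) -> R,
    [/\ psh_near (closure Omega) (EFin \o v),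
        smooth_near (closure Omega) v
      & forall x, closure Omega x -> `|u x - v x| <= eps].
Proof.
have [K0|] := pselect (closure Omega !=set0); last first.
  move=> /set0P/negP/negPn/eqP K0; exists u; rewrite K0; split=> //.
  - exists set0; split; [exact: open0|by []|split=> // a b c r r0 sV].
    (* A disc contains its centre, so the empty set contains no disc. *)
    by have := sV c; rewrite /= subrr normr0 lecR (ltW r0) => /(_ isT).
  - by exists set0; split=> //; exact: open0.
have cK : compact (closure Omega).
  apply: bounded_closed_compact; last exact: closed_closure.
  have [M [Mr hM]] := Omega_bounded; exists M; split=> // x Mx y cy.
  have : closed [set y : 'rV[R]_(n + n) | `|y| <= x].
    apply: (@closed_comp _ _ (fun y : 'rV[R]_(n + n) => `|y|) [set r : R | r <= x]);
      last exact: closed_le.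
    by move=> ? _; exact: norm_continuous.
  move=> /closure_id cE; have : closure [set y : 'rV[R]_(n + n) | `|y| <= x] y.
    by move: y cy; apply: closure_subset => z Oz; exact: hM.
  by rewrite -cE.
have [M [_ hM]] := compact_bounded (continuous_compact u_cont cK).
have M0 : 0 < `|M| + 1 by rewrite ltr_pwDr.
have uM x : closure Omega x -> `|u x| <= `|M| + 1.
  by move=> clx; apply: hM; [rewrite ltr_pwDr// ler_norm|exists x].
(* Tietze: off the closure nothing is known about [u], so it is replaced by a globally continuous
   function with the same values on the closure. *)
have [f [uf cf _]] := continuous_bounded_extension (@pseudometric_normal R _)
  (@closed_closure _ Omega) M0 u_cont uM.
have uf' x : closure Omega x -> u x = f x by move=> clx; apply: uf; rewrite inE.
have e20 : 0 < eps / 2 by rewrite divr_gt0.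
have [g [sigma [cg s0 fg sg]]] := psh_glue Omega_open Omega_C0 cK K0 u_psh cf
  (fun z Oz => uf' z (subset_closure Oz)) e20.
have [v [pv sv gv]] := psh_regularize cK s0 e20 cg sg.
exists v; split=> // x clx; rewrite uf'// -(subrK (g x) (f x)) -addrA.
by rewrite (le_trans (ler_normD _ _))// [leRHS]splitr lerD ?fg ?gv.
Qed.
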